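(* Let $\{\mathfrak{L}_n=(\widehat{\mathbb{L}}(\Delta^n),\partial)\}_{n\ge 0}$ be any sequence of compatible models of $\mathbf\Delta$. Then $\mathfrak{L}_\bullet=\{\mathfrak{L}_n\}_{n\ge 0}$ admits the structure of a cosimplicial differential graded Lie algebra whose cofaces are the usual ones; that is, there exist DGL morphisms (codegeneracies) $\sigma_i\colon\mathfrak{L}_{n+1}\to\mathfrak{L}_n$, $0\le i\le n$, $n\geq 0$, which together with the coface morphisms $\delta_i\colon \mathfrak{L}_{n-1}\to\mathfrak{L}_n$, $0\le i\le n$, $n\ge 1$, satisfy the cosimplicial identities.
   Context: The base field is $\mathbb{Q}$. A differential graded Lie algebra (DGL) is a $\mathbb{Z}$-graded Lie algebra $L$ with a linear derivation $\partial$ of degree $-1$, $\partial^2=0$. Put $L^1=L$, $L^n=[L,L^{n-1}]$; $L$ is complete if $L\cong\varprojlim_n L/L^n$. ''DGL'' means complete DGL. $\mathbb{L}(V)$ is the free graded Lie algebra on the graded vector space $V$, $\mathbb{L}^k(V)$ its part of bracket length $k$, $\widehat{\mathbb{L}}(V)=\varprojlim_n\mathbb{L}(V)/\mathbb{L}^{>n}(V)$. For a differential $\partial$ on $\widehat{\mathbb L}(V)$ and $v\in V$, write $\partial v=\sum_{n\ge1}\partial_n v$ with $\partial_nv\in\mathbb{L}^n(V)$; $\partial_1$ is the linear part. A Maurer-Cartan element of $(L,\partial)$ is $a\in L_{-1}$ with $\partial a+\frac12[a,a]=0$. $\widehat{\mathbb{L}}(\Delta^n)$ denotes the free complete graded Lie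 algebra on generators $a_{i_0\dots i_p}$ of degree $p-1$, one for each sequence $0\le i_0<\dots<i_p\le n$, $0\le p\le n$. Let $d$ be the linear differential $d a_{i_0\dots i_p}=\sum_{j=0}^p(-1)^ja_{i_0\dots\widehat{i_j}\dots i_p}$ ($d a_i=0$). For $0\le i\le n$, $\delta_i\colon\widehat{\mathbb{L}}(\Delta^{n-1})\to\widehat{\mathbb{L}}(\Delta^n)$ is the Lie morphism $\delta_i(a_{j_0\dots j_p})=a_{\ell_0\dots\ell_p}$, where $\ell_k=j_k$ if $j_k<i$ and $\ell_k=j_k+1$ if $j_k\ge i$. A sequence of compatible models of $\mathbf\Delta$ is a family of DGL's $\{(\widehat{\mathbb{L}}(\Delta^n),\partial)\}_{n\ge0}$ such that: (1) each generator $a_i$ is a Maurer-Cartan element; (2) the linear part $\partial_1$ of $\partial$ is $d$; (3) each $\delta_i\colon(\widehat{\mathbb{L}}(\Delta^{n-1}),\partial)\to(\widehat{\mathbb{L}}(\Delta^n),\partial)$ is a DGL morphism. *)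

(* Defs.v *)
From HB Require Import structures.
From mathcomp Require Import all_boot all_order all_algebra.
From mathcomp Require Import generic_quotient ring_quotient boolp functions.
From mathcomp Require Import zify ring.

Set Implicit Arguments.
Unset Strict Implicit.
Unset Printing Implicit Defensive.
Import Order.TTheory GRing.Theory Num.Theory.
Local Open Scope ring_scope.
Local Open Scope quotient_scope.

(* A graded vector space is a family indexed by the degree. To avoid          *)
(* transports between L (p + q) and L r, the bracket takes as an argument the *)
(* degree r of its result together with a proof of p + q = r.                 *)
Record gradedLie := GradedLie {
  gspace :> int -> lmodType rat;
  bracket : forall p q r : int, p + q = r -> gspace p -> gspace q -> gspace r;
  bracket_linearl : forall p q r (e : p + q = r) (y : gspace q) (a : rat)
    (x x' : gspace p),
    bracket e (a *: x + x') y = a *: bracket e x y + bracket e x' y;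
  bracket_linearr : forall p q r (e : p + q = r) (x : gspace p) (a : rat)
    (y y' : gspace q),
    bracket e x (a *: y + y') = a *: bracket e x y + bracket e x y';
  bracket_antisym : forall p q r (e : p + q = r) (e' : q + p = r)
    (x : gspace p) (y : gspace q),
    bracket e x y = - ((-1) ^ (p * q) *: bracket e' y x);
  bracket_jacobi : forall p q r pq qr pr s
    (e1 : p + q = pq) (e2 : q + r = qr) (e3 : p + r = pr)
    (f1 : pq + r = s) (f2 : p + qr = s) (f3 : q + pr = s)
    (x : gspace p) (y : gspace q) (z : gspace r),
    bracket f2 x (bracket e2 y z) =
      bracket f1 (bracket e1 x y) z
      + (-1) ^ (p * q) *: bracket f3 y (bracket e3 x z)
}.

Record differential (L : gradedLie) := Differential {
  dfun :> forall p : int, {linear L p -> L (p - 1)};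
  dfun_derivation : forall p q r (e : p + q = r)
    (el : p - 1 + q = r - 1) (er : p + (q - 1) = r - 1) (x : L p) (y : L q),
    dfun r (bracket e x y) =
      bracket el (dfun p x) y + (-1) ^ p *: bracket er x (dfun q y);
  dfun_sq : forall p (x : L p), dfun (p - 1) (dfun p x) = 0
}.

Lemma mc_degree : (-1) + (-1) = (-1) - 1 :> int.
Proof. by []. Qed.

Definition maurer_cartan (L : gradedLie) (D : differential L) (a : L (-1)) :=
  D (-1) a + (2%:R : rat)^-1 *: bracket mc_degree a a = 0.

Record lieHom (L M : gradedLie) := LieHom {
  lhom :> forall p : int, {linear L p -> M p};
  lhom_bracket : forall p q r (e : p + q = r) (x : L p) (y : L q),
    lhom r (bracket e x y) = bracket e (lhom p x) (lhom q y)
}.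

Definition is_dgl_hom (L M : gradedLie) (D : differential L)
    (E : differential M) (f : lieHom L M) :=
  forall p (x : L p), f (p - 1) (D p x) = E p (f p x).

Section FreeCompleteLie.
Variables (X : finType) (deg : X -> int).

Inductive tree := Leaf of X | Node of tree & tree.

Fixpoint tdeg t : int :=
  match t with Leaf x => deg x | Node s u => tdeg s + tdeg u end.

Fixpoint tlen t : nat :=
  match t with Leaf _ => 1%N | Node s u => (tlen s + tlen u)%N end.

(* A function tree -> rat is the formal series of bracketed words with these  *)
(* coefficients, that is an element of the completed free non-associative     *)
(* algebra on X; mbr is its product.                                          *)
Definition mbr (f g : tree -> rat^o) : tree -> rat^o :=
  fun t => match t with Leaf _ => 0 | Node s u => f s * g u end.

Definition homog (p : int) : {pred tree -> rat^o} :=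
  fun f => `[< forall t, f t != 0 -> tdeg t = p >].

Definition cut (k : nat) (f : tree -> rat^o) : tree -> rat^o :=
  fun t => if tlen t == k then f t else 0.

(* The two-sided ideal generated by graded antisymmetry and graded Jacobi.    *)
Inductive lieIdeal : int -> (tree -> rat^o) -> Prop :=
| LieIdeal0 p : lieIdeal p 0
| LieIdealD p a f g : lieIdeal p f -> lieIdeal p g -> lieIdeal p (a *: f + g)
| LieIdealAntisym p q f g : f \in homog p -> g \in homog q ->
    lieIdeal (p + q) (mbr f g + (-1) ^ (p * q) *: mbr g f)
| LieIdealJacobi p q r f g h :
    f \in homog p -> g \in homog q -> h \in homog r ->
    lieIdeal (p + q + r)
      (mbr f (mbr g h) - mbr (mbr f g) h
       - (-1) ^ (p * q) *: mbr g (mbr f h))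
| LieIdealMull p q f g : f \in homog p -> lieIdeal q g ->
    lieIdeal (p + q) (mbr f g)
| LieIdealMulr p q f g : lieIdeal p f -> g \in homog q ->
    lieIdeal (p + q) (mbr f g).

Let zeroE t : (0 : tree -> rat^o) t = 0. Proof. by []. Qed.
Let addE (f g : tree -> rat^o) t : (f + g) t = f t + g t. Proof. by []. Qed.
Let oppE (f : tree -> rat^o) t : (- f) t = - f t. Proof. by []. Qed.
Let scaleE a (f : tree -> rat^o) t : (a *: f) t = a * f t. Proof. by []. Qed.
Let funE := (zeroE, addE, oppE, scaleE).

Fact homogP p f :
  reflect (forall t, f t != 0 -> tdeg t = p) (f \in homog p).
Proof. exact: asboolP. Qed.

Fact homog_submod p : submod_closed (homog p).
Proof.
split=> [|a f g /homogP hf /homogP hg]; apply/homogP => t.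
  by rewrite funE eqxx.
have [ft0|/hf//] := eqVneq (f t) 0; have [gt0|/hg//] := eqVneq (g t) 0.
by rewrite !funE ft0 gt0 mulr0 addr0 eqxx.
Qed.
HB.instance Definition _ p :=
  GRing.isSubmodClosed.Build rat (tree -> rat^o) (homog p) (homog_submod p).

Record hseries (p : int) :=
  HSeries { hval : tree -> rat^o; hvalP : hval \in homog p }.
HB.instance Definition _ p := [isSub for @hval p].
HB.instance Definition _ p := [Choice of hseries p by <:].
HB.instance Definition _ p := [SubChoice_isSubLmodule of hseries p by <:].

Fact hval_linear p a (f g : hseries p) t :
  hval (a *: f + g) t = a * hval f t + hval g t.
Proof. by []. Qed.

(* Equality in lim_n L(V)/L^{>n}(V): the difference lies in the ideal modulo  *)
(* words of length > n, for every n. As X is finite, there are finitely many  *)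
(* trees of length <= n, so a series modulo words of length > n is an element *)
(* of the free non-associative algebra modulo such words.                     *)
Definition lieRel (p : int) : {pred hseries p} :=
  fun f => `[< forall n, exists2 g, lieIdeal p g &
                 forall t, (tlen t <= n)%N -> hval f t = g t >].

Fact lieRelP p (f : hseries p) :
  reflect (forall n, exists2 g, lieIdeal p g &
             forall t, (tlen t <= n)%N -> hval f t = g t) (f \in @lieRel p).
Proof. exact: asboolP. Qed.

Fact lieRel_submod p : submod_closed (@lieRel p).
Proof.
split=> [|a f g /lieRelP hf /lieRelP hg]; apply/lieRelP => n.
  by exists 0 => //; apply: LieIdeal0.
have [f' If' ff'] := hf n; have [g' Ig' gg'] := hg n.
exists (a *: f' + g'); first exact: LieIdealD.
by move=> t tn; rewrite [LHS]hval_linear ff' // gg'.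
Qed.
HB.instance Definition _ p :=
  GRing.isSubmodClosed.Build rat (hseries p) (@lieRel p) (@lieRel_submod p).

Definition freeLie_space (p : int) := {ideal_quot (@lieRel p)}.
HB.instance Definition _ p := GRing.Zmodule.on (freeLie_space p).
HB.instance Definition _ p := EqQuotient.on (freeLie_space p).

Definition cls p (f : hseries p) : freeLie_space p := \pi_(freeLie_space p) f.

Fact cls_eq p (f g : hseries p) : (cls f = cls g) <-> (f - g \in @lieRel p).
Proof.
have -> : (f - g \in @lieRel p) = (cls f == cls g).
  exact: Quotient.idealrBE.
by split=> [->|/eqP].
Qed.

Fact cls_repr p (x : freeLie_space p) : cls (repr x) = x.
Proof. exact: reprK. Qed.

Fact clsD p (f g : hseries p) : cls (f + g) = cls f + cls g.
Proof. exact: raddfD. Qed.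

Fact lieRel_repr p (f : hseries p) : repr (cls f) - f \in @lieRel p.
Proof. by apply/cls_eq; rewrite cls_repr. Qed.

Fact clsN p (f : hseries p) : cls (- f) = - cls f.
Proof. exact: raddfN. Qed.

Definition freeLie_scale p (a : rat) (x : freeLie_space p) : freeLie_space p :=
  cls (a *: repr x).

Fact clsZ p a (f : hseries p) : cls (a *: f) = freeLie_scale a (cls f).
Proof.
by apply/esym/cls_eq; rewrite -scalerBr; apply/rpredZ/lieRel_repr.
Qed.

Fact freeLie_scaleA p a b (x : freeLie_space p) :
  freeLie_scale a (freeLie_scale b x) = freeLie_scale (a * b) x.
Proof. by rewrite -(cls_repr x) -!clsZ scalerA. Qed.
Fact freeLie_scale1 p : left_id 1 (@freeLie_scale p).
Proof. by move=> x; rewrite -(cls_repr x) -!clsZ scale1r. Qed.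
Fact freeLie_scaleDr p : right_distributive (@freeLie_scale p) +%R.
Proof.
by move=> a x y; rewrite -(cls_repr x) -(cls_repr y) -!(clsD, clsZ) scalerDr.
Qed.
Fact freeLie_scaleDl p (x : freeLie_space p) :
  {morph (@freeLie_scale p)^~ x : a b / a + b}.
Proof. by move=> a b /=; rewrite -(cls_repr x) -!(clsD, clsZ) scalerDl. Qed.
HB.instance Definition _ p :=
  GRing.Zmodule_isLmodule.Build rat (freeLie_space p) (@freeLie_scaleA p)
    (@freeLie_scale1 p) (@freeLie_scaleDr p) (@freeLie_scaleDl p).

Fact cls_scale p a (f : hseries p) : cls (a *: f) = a *: cls f.
Proof. exact: clsZ. Qed.

Fact cls_linear p a (f g : hseries p) : cls (a *: f + g) = a *: cls f + cls g.
Proof. by rewrite clsD clsZ. Qed.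

Fact mbr_homog p q r (e : p + q = r) (f : hseries p) (g : hseries q) :
  mbr (hval f) (hval g) \in homog r.
Proof.
apply/homogP => -[x|s u]; first by [].
rewrite mulf_eq0 negb_or => /andP[fs gu] /=.
by rewrite (homogP _ _ (hvalP f) _ fs) (homogP _ _ (hvalP g) _ gu).
Qed.

Definition hbr p q r (e : p + q = r) (f : hseries p) (g : hseries q) :=
  HSeries (mbr_homog e f g).

Definition freeLie_bracket p q r (e : p + q = r)
    (x : freeLie_space p) (y : freeLie_space q) : freeLie_space r :=
  cls (hbr e (repr x) (repr y)).

Fact hval_inj p : injective (@hval p).
Proof. exact: val_inj. Qed.

Fact mbrDl a f f' g : mbr (a *: f + f') g = a *: mbr f g + mbr f' g.
Proof.
apply/funext => -[x|s u]; rewrite !funE /= ?mulr0 ?addr0//.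
by rewrite !funE mulrDl mulrA.
Qed.

Fact mbrDr a f g g' : mbr f (a *: g + g') = a *: mbr f g + mbr f g'.
Proof.
apply/funext => -[x|s u]; rewrite !funE /= ?mulr0 ?addr0//.
by rewrite !funE mulrDr mulrCA.
Qed.

Fact hbrDl p q r (e : p + q = r) a f f' (g : hseries q) :
  hbr e (a *: f + f') g = a *: hbr e f g + hbr e f' g.
Proof. by apply: hval_inj; rewrite /= mbrDl. Qed.

Fact hbrDr p q r (e : p + q = r) a (f : hseries p) g g' :
  hbr e f (a *: g + g') = a *: hbr e f g + hbr e f g'.
Proof. by apply: hval_inj; rewrite /= mbrDr. Qed.

Fact hbr_rell p q r (e : p + q = r) (f : hseries p) (g : hseries q) :
  f \in @lieRel p -> hbr e f g \in @lieRel r.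
Proof.
case: r / e => /lieRelP hf; apply/lieRelP => n; have [f' If' ff'] := hf n.
exists (mbr f' (hval g)); first exact/LieIdealMulr/hvalP.
by case=> //= s u le; rewrite ff'//; apply: leq_trans le; apply: leq_addr.
Qed.

Fact hbr_relr p q r (e : p + q = r) (f : hseries p) (g : hseries q) :
  g \in @lieRel q -> hbr e f g \in @lieRel r.
Proof.
case: r / e => /lieRelP hg; apply/lieRelP => n; have [g' Ig' gg'] := hg n.
exists (mbr (hval f) g'); first exact/LieIdealMull/Ig'/hvalP.
by case=> //= s u le; rewrite gg'//; apply: leq_trans le; apply: leq_addl.
Qed.

Fact freeLie_bracketE p q r (e : p + q = r) (f : hseries p) (g : hseries q) :
  freeLie_bracket e (cls f) (cls g) = cls (hbr e f g).
Proof.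
apply/cls_eq.
rewrite (_ : _ - _ = hbr e (repr (cls f) - f) (repr (cls g))
                     + hbr e f (repr (cls g) - g)).
  apply: rpredD; [apply: hbr_rell|apply: hbr_relr]; exact: lieRel_repr.
apply: hval_inj; apply/funext => -[x|s u]; rewrite /= !funE /= ?subrr ?addr0//.
by rewrite !funE; ring.
Qed.

Fact freeLie_linearl p q r (e : p + q = r) (y : freeLie_space q) (a : rat)
    (x x' : freeLie_space p) :
  freeLie_bracket e (a *: x + x') y =
    a *: freeLie_bracket e x y + freeLie_bracket e x' y.
Proof.
rewrite -(cls_repr x) -(cls_repr x') -(cls_repr y) -cls_linear !freeLie_bracketE.
by rewrite hbrDl cls_linear.
Qed.

Fact freeLie_linearr p q r (e : p + q = r) (x : freeLie_space p) (a : rat)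
    (y y' : freeLie_space q) :
  freeLie_bracket e x (a *: y + y') =
    a *: freeLie_bracket e x y + freeLie_bracket e x y'.
Proof.
rewrite -(cls_repr y) -(cls_repr y') -(cls_repr x) -cls_linear !freeLie_bracketE.
by rewrite hbrDr cls_linear.
Qed.

Fact lieIdeal_rel p (f : hseries p) :
  lieIdeal p (hval f) -> f \in @lieRel p.
Proof. by move=> If; apply/lieRelP => n; exists (hval f). Qed.

Fact freeLie_antisym p q r (e : p + q = r) (e' : q + p = r)
    (x : freeLie_space p) (y : freeLie_space q) :
  freeLie_bracket e x y = - ((-1) ^ (p * q) *: freeLie_bracket e' y x).
Proof.
rewrite -[x]cls_repr -[y]cls_repr !freeLie_bracketE -cls_scale -clsN.
apply/cls_eq/lieIdeal_rel; rewrite opprK; case: r / e e' => e'.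
exact: (LieIdealAntisym (hvalP (repr x)) (hvalP (repr y))).
Qed.

Fact freeLie_jacobi p q r pq qr pr s
    (e1 : p + q = pq) (e2 : q + r = qr) (e3 : p + r = pr)
    (f1 : pq + r = s) (f2 : p + qr = s) (f3 : q + pr = s)
    (x : freeLie_space p) (y : freeLie_space q) (z : freeLie_space r) :
  freeLie_bracket f2 x (freeLie_bracket e2 y z) =
    freeLie_bracket f1 (freeLie_bracket e1 x y) z
    + (-1) ^ (p * q) *: freeLie_bracket f3 y (freeLie_bracket e3 x z).
Proof.
rewrite -[x]cls_repr -[y]cls_repr -[z]cls_repr !freeLie_bracketE -cls_scale -clsD.
apply/cls_eq/lieIdeal_rel; rewrite opprD addrA.
case: pq / e1 f1 => f1; case: s / f1 f2 f3 => f2 f3.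
exact: (LieIdealJacobi (hvalP (repr x)) (hvalP (repr y)) (hvalP (repr z))).
Qed.

(* The free complete graded Lie algebra on the graded vector space with basis *)
(* X, x : X being of degree deg x.                                            *)
Definition freeLie : gradedLie :=
  GradedLie freeLie_linearl freeLie_linearr freeLie_antisym freeLie_jacobi.

(* For k : X, the generator k as an element of degree p; it is 0 when         *)
(* deg k <> p.                                                                *)
Definition gen_series (p : int) (k : X) : tree -> rat^o :=
  fun t => if t is Leaf x then ((x == k) && (deg x == p))%:R else 0.

Fact gen_homog p k : gen_series p k \in homog p.
Proof.
apply/homogP => -[x|s u] //=.
by case: (_ =P p); rewrite ?andbF.
Qed.

Definition gen (p : int) (k : X) : freeLie p := cls (HSeries (gen_homog p k)).

Fact cut_homog p k (f : hseries p) : cut k (hval f) \in homog p.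
Proof.
apply/homogP => t; rewrite /cut; case: ifP => _; last by rewrite eqxx.
exact/homogP/hvalP.
Qed.

(* The component of bracket length k.                                         *)
Definition lpart p (k : nat) (x : freeLie p) : freeLie p :=
  cls (HSeries (cut_homog k (repr x))).

Fact cutD k a f g : cut k (a *: f + g) = a *: cut k f + cut k g.
Proof.
apply/funext => t; rewrite /cut !funE; case: ifP => _; rewrite ?funE//.
by rewrite mulr0 addr0.
Qed.

Fact cut_mbr k f g :
  cut k (mbr f g) = \sum_(i < k.+1) mbr (cut i f) (cut (k - i) g).
Proof.
apply/funext => t; rewrite fct_sumE /cut; case: t => [x|s u] /=.
  by rewrite big1 ?if_same.
case: eqP => [<-|ne].
  have lt : (tlen s < (tlen s + tlen u).+1)%N by rewrite ltnS leq_addr.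
  rewrite (bigD1 (Ordinal lt)) //= eqxx addKn eqxx big1 ?addr0// => i.
  rewrite -val_eqE /= eq_sym => /negPf ->.
  by rewrite mul0r.
rewrite big1 // => i _; case: eqP => [si|]; last by rewrite mul0r.
case: eqP => [ui|]; last by rewrite mulr0.
by case: ne; rewrite ui si subnKC // -ltnS.
Qed.

Fact cut_homog' p k f : f \in homog p -> cut k f \in homog p.
Proof. by move=> hf; exact: (cut_homog k (HSeries hf)). Qed.

Fact lieIdeal_sum p (I : Type) (r : seq I) (P : pred I) F :
  (forall i, P i -> lieIdeal p (F i)) -> lieIdeal p (\sum_(i <- r | P i) F i).
Proof.
move=> IF; apply: big_ind => //; first exact: LieIdeal0.
by move=> f g If Ig; rewrite -[f]scale1r; apply: LieIdealD.
Qed.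


Let agree (k : nat) (f g : tree -> rat^o) :=
  forall t, (tlen t <= k)%N -> f t = g t.

Fact agree_ind (Q : (tree -> rat^o) -> Prop) k f :
  Q 0 -> (forall g h, Q g -> Q h -> Q (g + h)) ->
  (forall g h, agree k g h -> Q g -> Q h) ->
  (forall i, Q (cut i f)) -> Q f.
Proof.
move=> Q0 QD Qa Qf; apply: (Qa (\sum_(i < k.+1) cut i f)); last first.
  by apply: big_ind => // i _; apply: Qf.
move=> t le; rewrite fct_sumE /cut (bigD1 (Ordinal (le : _ < k.+1)%N)) //= eqxx.
rewrite big1 ?addr0 // => i; rewrite -val_eqE /= eq_sym => /negPf ->.
by [].
Qed.

Fact agree_mbr k f f' g g' :
  agree k f f' -> agree k g g' -> agree k (mbr f g) (mbr f' g').
Proof.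
move=> ff gg [x|s u] //= le.
by rewrite ff ?gg//; apply: leq_trans le; rewrite ?leq_addr ?leq_addl.
Qed.

Fact agree_lin k a f f' g g' :
  agree k f f' -> agree k g g' -> agree k (a *: f + g) (a *: f' + g').
Proof. by move=> ff gg t le; rewrite !funE ff ?gg. Qed.

Fact agree_cut k f g : agree k f g -> cut k f = cut k g.
Proof.
move=> fg; apply/funext => t; rewrite /cut; case: eqP => // tk.
by apply: fg; rewrite tk.
Qed.

Let lens (i : nat) (f : tree -> rat^o) := forall t, f t != 0 -> tlen t = i.

Fact lens_cut i f : lens i (cut i f).
Proof.
by move=> t; rewrite /cut; case: (tlen t =P i).
Qed.

Fact lens_mbr i j f g : lens i f -> lens j g -> lens (i + j) (mbr f g).
Proof.
move=> fi gj [x|s u]; first by [].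
by rewrite mulf_eq0 negb_or => /andP[/fi <- /gj <-].
Qed.

Fact lens_lin i a f g : lens i f -> lens i g -> lens i (a *: f + g).
Proof.
move=> fi gi t; have [ft0|/fi//] := eqVneq (f t) 0.
by have [gt0|/gi//] := eqVneq (g t) 0; rewrite !funE ft0 gt0 mulr0 addr0 eqxx.
Qed.

Fact lieIdeal_cut_lens p k i f : lens i f -> lieIdeal p f ->
  lieIdeal p (cut k f).
Proof.
move=> fi If; suff -> : cut k f = if i == k then f else 0.
  by case: ifP => // _; apply: LieIdeal0.
apply/funext => t; rewrite /cut (fun_if (fun h : tree -> rat^o => h t)) funE.
have [->|/fi ->//] := eqVneq (f t) 0.
by rewrite !if_same.
Qed.

Let ant c f g := mbr f g + c *: mbr g f.
Let jac c f g h := mbr f (mbr g h) - mbr (mbr f g) h - c *: mbr g (mbr f h).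

Let cut_ind p k (J : (tree -> rat^o) -> tree -> rat^o) f :
  (forall g h, J (g + h) = J g + J h) ->
  (forall g h, agree k g h -> agree k (J g) (J h)) ->
  (forall i, lieIdeal p (cut k (J (cut i f)))) -> lieIdeal p (cut k (J f)).
Proof.
move=> JD Ja Jf; have cutA g h : cut k (g + h) = cut k g + cut k h.
  by have := cutD k 1 g h; rewrite !scale1r.
apply: (@agree_ind (fun f => lieIdeal p (cut k (J f))) k) => //.
- have -> : J 0 = 0 by apply: (addrI (J 0)); rewrite -JD !addr0.
  suff -> : cut k 0 = 0 by apply: LieIdeal0.
  by apply/funext => t; rewrite /cut if_same.
- move=> g h Ig Ih; rewrite JD cutA -[cut k (J g)]scale1r.
  exact: LieIdealD.
- by move=> g h /Ja/agree_cut ->.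
Qed.

Let mbrA f f' g : mbr (f + f') g = mbr f g + mbr f' g.
Proof. by have := mbrDl 1 f f' g; rewrite !scale1r. Qed.
Let mbrB f g g' : mbr f (g + g') = mbr f g + mbr f g'.
Proof. by have := mbrDr 1 f g g'; rewrite !scale1r. Qed.

Let agree_refl k f : agree k f f. Proof. by []. Qed.

Let agree_ant k c f f' g g' : agree k f f' -> agree k g g' ->
  agree k (ant c f g) (ant c f' g').
Proof.
by move=> ff gg t le; rewrite /ant !funE (agree_mbr ff gg)// (agree_mbr gg ff).
Qed.

Let agree_jac k c f f' g g' h h' :
  agree k f f' -> agree k g g' -> agree k h h' ->
  agree k (jac c f g h) (jac c f' g' h').
Proof.
move=> ff gg hh t le; rewrite /jac !funE (agree_mbr ff (agree_mbr gg hh))//.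
rewrite (agree_mbr (agree_mbr ff gg) hh)//.
by rewrite (agree_mbr gg (agree_mbr ff hh)).
Qed.

Fact lieIdeal_cut p k f : lieIdeal p f -> lieIdeal p (cut k f).
Proof.
move=> If; elim: If k => {p f}.
- move=> p k; suff -> : cut k 0 = 0 by apply: LieIdeal0.
  by apply/funext => t; rewrite /cut if_same.
- by move=> p a f g _ IHf _ IHg k; rewrite cutD; apply: LieIdealD.
- move=> p q f g fp gq k; set c := _ ^ _.
  apply: (@cut_ind _ _ (ant c ^~ g)) => [f1 f2|f1 f2 ff|i].
  + by rewrite /ant mbrA mbrB scalerDr addrACA.
  + exact: agree_ant.
  apply: (@cut_ind _ _ (ant c (cut i f))) => [g1 g2|g1 g2 gg|j].
  + by rewrite /ant mbrA mbrB scalerDr addrACA.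
  + exact: agree_ant.
  apply: (@lieIdeal_cut_lens _ _ (i + j)).
    rewrite /ant addrC; apply: lens_lin; last exact/lens_mbr/lens_cut/lens_cut.
    by rewrite addnC; exact/lens_mbr/lens_cut/lens_cut.
  by apply: LieIdealAntisym; apply: cut_homog'.
- move=> p q r f g h fp gq hr k; set c := _ ^ _.
  apply: (@cut_ind _ _ (fun f => jac c f g h)) => [f1 f2|f1 f2 ff|i].
  + rewrite /jac !(mbrA, mbrB) scalerDr; apply/funext => t; rewrite !funE; ring.
  + exact: agree_jac.
  apply: (@cut_ind _ _ (fun g => jac c (cut i f) g h)) => [g1 g2|g1 g2 gg|j].
  + rewrite /jac !(mbrA, mbrB) scalerDr; apply/funext => t; rewrite !funE; ring.
  + exact: agree_jac.
  apply: (@cut_ind _ _ (jac c (cut i f) (cut j g))) => [h1 h2|h1 h2 hh|l].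
  + rewrite /jac !(mbrA, mbrB) scalerDr; apply/funext => t; rewrite !funE; ring.
  + exact: agree_jac.
  apply: (@lieIdeal_cut_lens _ _ (i + j + l)).
    rewrite /jac addrC -scaleNr; apply: lens_lin.
      rewrite [(i + j)%N]addnC -addnA.
      exact/lens_mbr/lens_mbr/lens_cut/lens_cut/lens_cut.
    rewrite addrC -scaleN1r; apply: lens_lin.
      exact/lens_mbr/lens_cut/lens_mbr/lens_cut/lens_cut.
    by rewrite -addnA; exact/lens_mbr/lens_mbr/lens_cut/lens_cut/lens_cut.
  by apply: LieIdealJacobi; apply: cut_homog'.
- move=> p q f g fp _ IHg k; rewrite cut_mbr; apply: lieIdeal_sum => i _.
  by apply: LieIdealMull => //; apply: cut_homog'.
- move=> p q f g _ IHf gq k; rewrite cut_mbr; apply: lieIdeal_sum => i _.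
  by apply: LieIdealMulr => //; apply: cut_homog'.
Qed.

Fact lpartE p k (f : hseries p) :
  lpart k (cls f) = cls (HSeries (cut_homog k f)).
Proof.
apply/cls_eq/lieRelP => n; have /lieRelP/(_ k)[g Ig fg] := lieRel_repr f.
exists (cut k g); first exact: lieIdeal_cut.
move=> t _; rewrite -(agree_cut fg) /cut /= !funE /=.
by case: ifP => // _; rewrite subr0.
Qed.

End FreeCompleteLie.

Section Push.
Variables (X Y : finType) (degX : X -> int) (degY : Y -> int) (phi : X -> Y).
Hypothesis phi_deg : forall x, degY (phi x) = degX x.

Fixpoint tmap (t : tree X) : tree Y :=
  match t with
  | Leaf x => Leaf (phi x)
  | Node s u => Node (tmap s) (tmap u)
  end.

(* The coefficient at t of the pushforward: the sum of f over tmap @^-1 t.    *)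
Fixpoint pushc (t : tree Y) (f : tree X -> rat^o) : rat :=
  match t with
  | Leaf y => \sum_(x | phi x == y) f (Leaf x)
  | Node s u => pushc s (fun v => pushc u (fun w => f (Node v w)))
  end.

Definition push (f : tree X -> rat^o) : tree Y -> rat^o := fun t => pushc t f.

Fact pushcD t a (f g : tree X -> rat^o) :
  pushc t (fun s => a * f s + g s) = a * pushc t f + pushc t g.
Proof.
elim: t f g => [y|s IHs u IHu] f g /=; first by rewrite big_split mulr_sumr.
rewrite -IHs; congr pushc; apply/funext => v; exact: IHu.
Qed.

Fact pushc0 t (f : tree X -> rat^o) :
  (forall s, tmap s = t -> f s = 0) -> pushc t f = 0.
Proof.
elim: t f => [y|s IHs u IHu] f f0 /=.
  by apply: big1 => x /eqP xy; apply: f0; rewrite /= xy.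
by apply: IHs => v vs; apply: IHu => w wu; apply: f0; rewrite /= vs wu.
Qed.

Fact pushcZ t a (f : tree X -> rat^o) :
  pushc t (fun s => a * f s) = a * pushc t f.
Proof.
have /= := pushcD t a f (fun=> 0); rewrite (@pushc0 t (fun=> 0)) // addr0 => <-.
by congr pushc; apply/funext => s; rewrite addr0.
Qed.

Fact push_linear a f g : push (a *: f + g) = a *: push f + push g.
Proof. by apply/funext => t; apply: pushcD. Qed.

Fact push_mbr f g : push (mbr f g) = mbr (push f) (push g).
Proof.
apply/funext => -[y|s u]; rewrite /push /=; first by rewrite big1.
rewrite -[RHS]/((pushc s f : rat) * pushc u g) mulrC -pushcZ.
congr pushc; apply/funext => v; rewrite mulrC -pushcZ.
by [].
Qed.

Fact tdeg_tmap t : tdeg degY (tmap t) = tdeg degX t.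
Proof. by elim: t => [x|s IHs u IHu] /=; rewrite ?phi_deg // IHs IHu. Qed.

Fact tlen_tmap t : tlen (tmap t) = tlen t.
Proof. by elim: t => [x|s IHs u IHu] //=; rewrite IHs IHu. Qed.

Fact push_homog p f : f \in homog degX p -> push f \in homog degY p.
Proof.
move=> /homogP fp; apply/homogP => t; apply: contra_neqP => /eqP tp.
apply: pushc0 => s st; apply/eqP/contraT => /fp sp.
by rewrite -st tdeg_tmap sp eqxx in tp.
Qed.

Fact push_agree n f g :
  (forall t, (tlen t <= n)%N -> f t = g t) ->
  forall t, (tlen t <= n)%N -> push f t = push g t.
Proof.
move=> fg t tn; apply/eqP; rewrite -subr_eq0 addrC -mulN1r -pushcD; apply/eqP.
apply: pushc0 => s st; rewrite fg ?mulN1r ?addNr//.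
by rewrite -tlen_tmap st.
Qed.

Fact lieIdeal_push p f : lieIdeal degX p f -> lieIdeal degY p (push f).
Proof.
have push0 : push 0 = 0 by apply/funext => t; apply: pushc0.
have pushZ a g : push (a *: g) = a *: push g.
  by rewrite -[a *: g]addr0 push_linear push0 addr0.
have pushD g h : push (g + h) = push g + push h.
  by have := push_linear 1 g h; rewrite !scale1r.
have pushN g : push (- g) = - push g by rewrite -scaleN1r pushZ scaleN1r.
elim=> {p f}.
- by move=> p; rewrite push0; apply: LieIdeal0.
- by move=> p a f g _ IHf _ IHg; rewrite push_linear; apply: LieIdealD.
- move=> p q f g fp gq; rewrite pushD pushZ !push_mbr.
  by apply: LieIdealAntisym; apply: push_homog.
- move=> p q r f g h fp gq hr; rewrite !(pushD, pushN) pushZ !push_mbr.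
  by apply: LieIdealJacobi; apply: push_homog.
- move=> p q f g fp _ IHg; rewrite push_mbr.
  by apply: LieIdealMull => //; apply: push_homog.
- move=> p q f g _ IHf gq; rewrite push_mbr.
  by apply: LieIdealMulr => //; apply: push_homog.
Qed.

Definition hpush p (f : hseries degX p) : hseries degY p :=
  HSeries (push_homog (hvalP f)).

Definition freeLie_push p (x : freeLie degX p) : freeLie degY p :=
  cls (hpush (repr x)).

Fact freeLie_pushE p (f : hseries degX p) :
  freeLie_push (cls f) = cls (hpush f).
Proof.
apply/cls_eq/lieRelP => n; have /lieRelP/(_ n)[g Ig fg] := lieRel_repr f.
exists (push g); first exact: lieIdeal_push.
move=> t tn; rewrite -(push_agree fg tn).
rewrite [hval (repr (cls f) - f)](_ : _ = hval (repr (cls f)) - hval f)//.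
have := push_linear (-1) (hval f) (hval (repr (cls f))).
by rewrite !scaleN1r ![- _ + _]addrC => ->.
Qed.

Fact freeLie_push_linear p : linear (@freeLie_push p).
Proof.
move=> a x y; rewrite -[x]cls_repr -[y]cls_repr -cls_linear !freeLie_pushE.
rewrite -cls_linear; congr cls; apply: hval_inj; exact: push_linear.
Qed.
HB.instance Definition _ p :=
  GRing.isLinear.Build rat (freeLie degX p) (freeLie degY p) *:%R
    (@freeLie_push p) (@freeLie_push_linear p).

Fact freeLie_push_bracket p q r (e : p + q = r)
    (x : freeLie degX p) (y : freeLie degX q) :
  freeLie_push (bracket e x y) = bracket e (freeLie_push x) (freeLie_push y).
Proof.
rewrite /freeLie /= -[x]cls_repr -[y]cls_repr freeLie_bracketE !freeLie_pushE.
rewrite freeLie_bracketE; congr cls; apply: hval_inj; exact: push_mbr.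
Qed.

(* The Lie morphism extending the map phi on generators.                      *)
Definition freeLie_map : lieHom (freeLie degX) (freeLie degY) :=
  @LieHom (freeLie degX) (freeLie degY)
    (fun p => @freeLie_push p : {linear _ -> _}) freeLie_push_bracket.

Lemma freeLie_map_gen p k :
  freeLie_map p (gen degX p k) = gen degY p (phi k).
Proof.
rewrite /gen /= freeLie_pushE; congr cls; apply: hval_inj.
apply/funext => -[y|s u]; rewrite /= /push /=; last first.
  by apply: pushc0 => v _; apply: pushc0.
have [<-|yk] := eqVneq (phi k) y.
  rewrite (bigD1 k) //= !eqxx phi_deg big1 ?addr0 // => x /andP[_ /negPf ->].
  by [].
rewrite big1 // => x /eqP xy.
by case: eqP => // xk; rewrite -xy xk eqxx in yk.
Qed.

End Push.

Section Simplex.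
Variable n : nat.

(* A sequence 0 <= i_0 < ... < i_p <= n is given by its set of terms.         *)
Definition simplex := {J : {set 'I_n.+1} | J != set0}.

Definition sdeg (J : {set 'I_n.+1}) : int := #|J|%:Z - 2%:Z.

Definition simplex_deg (K : simplex) : int := sdeg (val K).

Definition simplexLie : gradedLie := freeLie simplex_deg.

(* a_J as an element of degree p: it is 0 unless p = sdeg J; also a_set0 = 0. *)
Definition sgen (p : int) (J : {set 'I_n.+1}) : simplexLie p :=
  if insub J is Some K then gen simplex_deg p K else 0.

(* If x is the j-th term of J, starting from j = 0, then j is the number of   *)
(* terms of J smaller than x.                                                 *)
Definition slin (J : {set 'I_n.+1}) : simplexLie (sdeg J - 1) :=
  \sum_(x in J)
    (-1 : rat) ^+ #|[set y in J | (y < x)%N]| *: sgen (sdeg J - 1) (J :\ x).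

End Simplex.

Section Coface.
Variables (n : nat) (i : 'I_n.+2).

Fact coface_proof (K : simplex n) : lift i @: val K != set0.
Proof. by rewrite imset_eq0 (valP K). Qed.

Definition coface_simplex (K : simplex n) : simplex n.+1 :=
  Sub (lift i @: val K) (coface_proof K).

Fact coface_deg (K : simplex n) :
  simplex_deg (coface_simplex K) = simplex_deg K.
Proof. by rewrite /simplex_deg /sdeg card_imset //; apply: lift_inj. Qed.

Definition coface : lieHom (simplexLie n) (simplexLie n.+1) :=
  freeLie_map coface_deg.

Lemma coface_sgen p (J : {set 'I_n.+1}) :
  coface p (sgen p J) = sgen p (lift i @: J).
Proof.
rewrite /sgen; case: insubP => [K _ <-|]; last first.
  by rewrite negbK => /eqP ->; rewrite imset0 insubF ?eqxx // linear0.
rewrite (_ : insub _ = Some (coface_simplex K)); last exact: insubT.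
exact: freeLie_map_gen.
Qed.

End Coface.

Record compatible_models (D : forall n, differential (simplexLie n)) : Prop := {
  models_mc : forall n (i : 'I_n.+1),
    maurer_cartan (D n) (sgen (-1) [set i]);
  models_linear : forall n (J : {set 'I_n.+1}), J != set0 ->
    lpart 1 (D n (sdeg J) (sgen (sdeg J) J)) = slin J;
  models_coface : forall n (i : 'I_n.+2),
    is_dgl_hom (D n) (D n.+1) (coface i)
}.

(* As the index types depend on the level, i' and j' are i and j seen in the  *)
(* other index type, and i1 and j1 are the shifted indices.                   *)
Record cosimplicial_identities (L : nat -> gradedLie)
    (delta : forall n, 'I_n.+2 -> lieHom (L n) (L n.+1))
    (sigma : forall n, 'I_n.+1 -> lieHom (L n.+1) (L n)) : Prop := {
  (* delta_j delta_i = delta_i delta_(j-1) for i < j *)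
  cosimplicial_dd : forall n (i j1 : 'I_n.+2) (i' j : 'I_n.+3),
    i' = i :> nat -> j = j1.+1 :> nat -> (i < j)%N ->
    forall p (x : L n p),
      delta n.+1 j p (delta n i p x) = delta n.+1 i' p (delta n j1 p x);
  (* sigma_j sigma_i = sigma_i sigma_(j+1) for i <= j *)
  cosimplicial_ss : forall n (i j1 : 'I_n.+2) (i' j : 'I_n.+1),
    i' = i :> nat -> j1 = j.+1 :> nat -> (i <= j)%N ->
    forall p (x : L n.+2 p),
      sigma n j p (sigma n.+1 i p x) = sigma n i' p (sigma n.+1 j1 p x);
  (* sigma_j delta_i = delta_i sigma_(j-1) for i < j *)
  cosimplicial_sd_lt : forall n (i : 'I_n.+3) (j : 'I_n.+2)
      (i' : 'I_n.+2) (j1 : 'I_n.+1),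
    i' = i :> nat -> j = j1.+1 :> nat -> (i < j)%N ->
    forall p (x : L n.+1 p),
      sigma n.+1 j p (delta n.+1 i p x) = delta n i' p (sigma n j1 p x);
  cosimplicial_sd_id : forall n (i : 'I_n.+2) (j : 'I_n.+1),
    i = j :> nat \/ i = j.+1 :> nat ->
    forall p (x : L n p), sigma n j p (delta n i p x) = x;
  (* sigma_j delta_i = delta_(i-1) sigma_j for i > j + 1 *)
  cosimplicial_sd_gt : forall n (i : 'I_n.+3) (j : 'I_n.+2)
      (i1 : 'I_n.+2) (j' : 'I_n.+1),
    i = i1.+1 :> nat -> j' = j :> nat -> (j.+1 < i)%N ->
    forall p (x : L n.+1 p),
      sigma n.+1 j p (delta n.+1 i p x) = delta n i1 p (sigma n j' p x)
}.

Record cosimplicial_dgl (L : nat -> gradedLie)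
    (D : forall n, differential (L n))
    (delta : forall n, 'I_n.+2 -> lieHom (L n) (L n.+1))
    (sigma : forall n, 'I_n.+1 -> lieHom (L n.+1) (L n)) : Prop := {
  cosimplicial_coface : forall n (i : 'I_n.+2),
    is_dgl_hom (D n) (D n.+1) (delta n i);
  cosimplicial_codegeneracy : forall n (i : 'I_n.+1),
    is_dgl_hom (D n.+1) (D n) (sigma n i);
  cosimplicial_ids : cosimplicial_identities delta sigma
}.

(* Main.v *)
Require Import Defs.
From HB Require Import structures.
From mathcomp Require Import all_boot all_order all_algebra.
From mathcomp Require Import generic_quotient boolp functions.
From mathcomp Require Import zify ring.

Set Implicit Arguments.
Unset Strict Implicit.
Unset Printing Implicit Defensive.
Import Order.TTheory GRing.Theory Num.Theory.
Local Open Scope ring_scope.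

(** Write a_J for the generator attached to a set J of vertices.  A map f of
    vertices induces the Lie morphism a_J |-> a_(f J), or 0 if f is not
    injective on J ([vertexMap]).  These morphisms are functorial in f, so the
    ones s_i induced by the degeneracies satisfy the cosimplicial identities
    with the cofaces; they need not commute with the given differentials D_n.
    The idea is to straighten the D_n: there are automorphisms psi_n of L_n
    which are the identity up to longer brackets, commute with the cofaces, and
    are such that the conjugates D'_n = psi_n^-1 D_n psi_n commute with the s_i
    ([straighten]).  Then sigma_i = psi_n s_i psi_(n+1)^-1 are morphisms for
    the original differentials and inherit all the identities.

    Here psi_n is [cellMap w n] and D'_n is [conjD D w n].  As the psi_n commute
    with the cofaces, they are determined by the images
    w_m of the top cells, one for each m.  These are chosen by induction on m.
    Once the levels up to n are straight, the only condition left at level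
    n + 1 is that s_i kills omega = D'_(n+1) a_top, for all i.  It is met by
    successive approximation along the filtration [fil] by bracket length.
    Modulo [fil 2] it holds because s_i kills the linear part of omega
    ([vertexMap_codegen_slin]).  If all s_i omega lie in [fil k] with k >= 2,
    the cosimplicial identities give z in [fil k] which has the same images as
    omega under the s_i and is a cycle modulo longer brackets ([normalize]).
    Now z has degree n - 1 >= -1, and in such degrees the linear differential
    is acyclic on brackets of length k >= 2 ([simplex_acyclic]); so z agrees
    with some D' y up to longer brackets, and replacing w by w - psi y moves
    all the s_i omega into [fil (k + 1)] ([straighten_step]).  The corrections
    converge since the Lie algebras are complete.

    Acyclicity comes from the cone h : a_J |-> a_(0 J), a homotopy between the
    identity of the generators and the projection to the vertex a_0.  Extended
    as a derivation, it makes E = D' h + h D' a derivation of degree 0 which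
    commutes with D'.  On brackets of length k, modulo longer ones, E is
    diagonalizable: in terms of a_0, the a_i - a_0 and the other generators, the
    eigenvalue of a bracket counts its factors other than a_0, so that the
    eigenvalue 0 only occurs in degree -k.  In any other degree a cycle z is a
    sum of eigenvectors with nonzero eigenvalues, hence a boundary, because
    E z = D' (h z) modulo longer brackets ([graded_acyclic]).

    Arbitrary derivations and morphisms have to be controlled along the
    filtration.  Since there are finitely many generators, an element of
    [fil (k + 1)] is exactly a finite sum of brackets of a generator with an
    element of [fil k] ([fil_genspan]); so derivations and morphisms are
    automatically continuous and determined by their values on the generators
    ([fil_growth]).  Conversely these values can be prescribed ([freeLie_lift],
    [freeLie_derivation_lift]). *)

(** * The filtration by bracket length *)

HB.instance Definition _ (X : finType) := gen_eqMixin (tree X).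

Section Filtration.
Variables (X : finType) (deg : X -> int).
Local Notation L := (freeLie deg).
Implicit Types (p q r : int) (k : nat).

(** The closure of the span of the brackets of length at least k.  It is defined
    by representatives rather than by the vanishing of the components of
    bracket length smaller than k, so that infinite sums can be handled at the
    level of series. *)
Definition fil k p : {pred L p} :=
  fun x => `[< exists2 f : hseries deg p, cls f = x
                & forall t, (tlen t < k)%N -> hval f t = 0 >].

Arguments fil k {p}.

Lemma filP k p (x : L p) :
  reflect (exists2 f : hseries deg p, cls f = x
             & forall t, (tlen t < k)%N -> hval f t = 0) (x \in fil k).
Proof. exact: asboolP. Qed.

Fact fil_submod k p : submod_closed (@fil k p).
Proof.
split=> [|a x y /filP[f <- fk] /filP[g <- gk]]; apply/filP.
  by exists 0 => //; exact: raddf0.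
exists (a *: f + g); first exact: cls_linear.
by move=> t tk; rewrite hval_linear fk// gk// mulr0 addr0.
Qed.
HB.instance Definition _ k p :=
  GRing.isSubmodClosed.Build rat (L p) (@fil k p) (@fil_submod k p).

Lemma tlen_gt0 (t : tree X) : (0 < tlen t)%N.
Proof. by elim: t => //= s IHs u _; rewrite addn_gt0 IHs. Qed.

Lemma fil1 p (x : L p) : x \in fil 1.
Proof.
apply/filP; exists (repr x); first exact: cls_repr.
by move=> t; rewrite ltnS leqNgt tlen_gt0.
Qed.

Lemma filW k l p (x : L p) : (k <= l)%N -> x \in fil l -> x \in fil k.
Proof.
move=> kl /filP[f fx fl]; apply/filP; exists f => // t tk.
exact/fl/(leq_trans tk).
Qed.

Lemma fil_bracket j k p q r (e : p + q = r) (x : L p) (y : L q) :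
  x \in fil j -> y \in fil k -> bracket e x y \in fil (j + k).
Proof.
move=> /filP[f <- fj] /filP[g <- gk]; apply/filP.
exists (hbr e f g); first by rewrite /= freeLie_bracketE.
case=> [//|s u] /= lt; have [sj|js] := ltnP (tlen s) j.
  by rewrite fj// mul0r.
by rewrite [hval g u]gk ?mulr0//; lia.
Qed.

Lemma fil_separated p (x : L p) : (forall k, x \in fil k) -> x = 0.
Proof.
move=> xk; rewrite -[x]cls_repr -[RHS](raddf0 (@cls X deg p)).
apply/cls_eq/lieRelP => n; rewrite subr0.
have /filP[f fx fn] := xk n.+1.
have /cls_eq/lieRelP/(_ n)[g Ig gE] : cls (repr x) = cls f by rewrite cls_repr.
exists g => // t tn; rewrite -gE//.
have -> : hval (repr x - f) t = hval (repr x) t - hval f t by [].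
by rewrite (fn t) // subr0.
Qed.

Lemma hval_sum p (I : Type) (r : seq I) (P : pred I) (F : I -> hseries deg p) t :
  hval (\sum_(i <- r | P i) F i) t = \sum_(i <- r | P i) hval (F i) t.
Proof. by elim/big_rec2: _ => // i y f _ <-. Qed.

(** The coefficient of the limit at a word of length l is already that of
    u (l + 1), so the limit is represented by a series with finite sums as
    coefficients. *)
Lemma fil_complete p (u : nat -> L p) :
  (forall k, u k.+1 - u k \in fil k) -> exists x, forall k, x - u k \in fil k.
Proof.
move=> uS.
have [g gE] : exists g : nat -> hseries deg p, forall k,
    cls (g k) = u k.+1 - u k /\ forall t, (tlen t < k)%N -> hval (g k) t = 0.
  have gex k : {g : hseries deg p | cls g = u k.+1 - u k /\
      forall t, (tlen t < k)%N -> hval g t = 0}.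
    by apply: cid; have /filP[g] := uS k; exists g.
  by exists (fun k => sval (gex k)) => k; exact: svalP (gex k).
pose s t : rat^o :=
  hval (repr (u 0)) t + \sum_(i < (tlen t).+1) hval (g i) t.
have sp : s \in homog deg p.
  apply/homogP => t; apply: contra_neqP => /eqP tp.
  have z (f : hseries deg p) : hval f t = 0.
    by apply/eqP/contraT => /(homogP _ _ _ (hvalP f))/eqP; rewrite (negPf tp).
  by rewrite /s z big1 ?addr0.
exists (cls (HSeries sp)) => k.
have -> : u k = cls (repr (u 0) + \sum_(i < k) g i).
  elim: k => [|k IHk]; first by rewrite big_ord0 addr0 cls_repr.
  by rewrite big_ord_recr /= addrA clsD -IHk (proj1 (gE k)) addrC subrK.
apply/filP; exists (HSeries sp - (repr (u 0) + \sum_(i < k) g i)).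
  by rewrite clsD clsN.
move=> t tk.
have -> : hval (HSeries sp - (repr (u 0) + \sum_(i < k) g i)) t
   = s t - (hval (repr (u 0)) t + hval (\sum_(i < k) g i) t) by [].
rewrite hval_sum opprD addrACA subrr add0r.
rewrite -!(big_mkord xpredT (fun i => hval (g i) t)) (big_cat_nat _ tk)//=.
rewrite opprD addrA subrr add0r big_nat_cond big1 ?oppr0// => i.
by rewrite andbT => /andP[ti _]; apply: (proj2 (gE i)).
Qed.
End Filtration.
Arguments fil {X deg} k {p}.

(** * Finite generation of the filtration *)

Section BracketLinear.
Variable L : gradedLie.
Implicit Types (p q r : int).

Lemma bracketDl p q r (e : p + q = r) (x x' : L p) (y : L q) :
  bracket e (x + x') y = bracket e x y + bracket e x' y.
Proof. by have := bracket_linearl e y 1 x x'; rewrite !scale1r. Qed.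

Lemma bracketDr p q r (e : p + q = r) (x : L p) (y y' : L q) :
  bracket e x (y + y') = bracket e x y + bracket e x y'.
Proof. by have := bracket_linearr e x 1 y y'; rewrite !scale1r. Qed.

Lemma bracket0l p q r (e : p + q = r) (y : L q) : bracket e (0 : L p) y = 0.
Proof. by apply: (addrI (bracket e 0 y)); rewrite -bracketDl !addr0. Qed.

Lemma bracket0r p q r (e : p + q = r) (x : L p) : bracket e x (0 : L q) = 0.
Proof. by apply: (addrI (bracket e x 0)); rewrite -bracketDr !addr0. Qed.

Lemma bracketZl p q r (e : p + q = r) a (x : L p) (y : L q) :
  bracket e (a *: x) y = a *: bracket e x y.
Proof. by have := bracket_linearl e y a x 0; rewrite bracket0l !addr0. Qed.

Lemma bracketZr p q r (e : p + q = r) a (x : L p) (y : L q) :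
  bracket e x (a *: y) = a *: bracket e x y.
Proof. by have := bracket_linearr e x a y 0; rewrite bracket0r !addr0. Qed.

Lemma bracketBl p q r (e : p + q = r) (x x' : L p) (y : L q) :
  bracket e (x - x') y = bracket e x y - bracket e x' y.
Proof. by rewrite -scaleN1r bracketDl bracketZl scaleN1r. Qed.

Lemma bracketBr p q r (e : p + q = r) (x : L p) (y y' : L q) :
  bracket e x (y - y') = bracket e x y - bracket e x y'.
Proof. by rewrite -scaleN1r bracketDr bracketZr scaleN1r. Qed.
End BracketLinear.

Section Span.
Variables (X : finType) (deg : X -> int).
Local Notation L := (freeLie deg).
Local Notation gen := (gen deg).
Implicit Types (p q r : int) (k : nat).

(** The bracketed word t as an element of degree p; it is 0 when t has another
    degree, in the same way as for the generators. *)
Definition mono_series p (t : tree X) : tree X -> rat^o :=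
  fun t' => ((t' == t) && (tdeg deg t == p))%:R.

Fact mono_homog p t : mono_series p t \in homog deg p.
Proof.
apply/homogP => t'; rewrite /mono_series pnatr_eq0 eqb0 negbK.
by move=> /andP[/eqP-> /eqP].
Qed.

Definition mono p t : L p := cls (HSeries (mono_homog p t)).

Lemma mono_leaf p a : mono p (Leaf a) = gen p a.
Proof.
congr cls; apply: hval_inj; apply/funext => -[x|s u]; rewrite /= /mono_series /=.
  congr ((_ : bool)%:R).
  by apply/andP/andP => [[/eqP[->]]|[/eqP->]].
by case: eqP.
Qed.

Lemma mono_node p q r (e : p + q = r) s u :
  tdeg deg s = p -> tdeg deg u = q ->
  mono r (Node s u) = bracket e (mono p s) (mono q u).
Proof.
move=> sp uq; rewrite /= freeLie_bracketE; congr cls; apply: hval_inj.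
apply/funext => -[x|s' u']; rewrite /= /mono_series /= sp uq e !eqxx !andbT.
  by case: eqP.
have -> : (Node s' u' == Node s u) = (s' == s) && (u' == u).
  by apply/eqP/andP => [[-> ->]|[/eqP-> /eqP->]].
by case: (s' == s); rewrite ?mul1r ?mul0r.
Qed.

Lemma fil_mono p t : mono p t \in fil (tlen t).
Proof.
apply/filP; exists (HSeries (mono_homog p t)) => // t' /=.
by rewrite /mono_series; case: eqP => [->|//]; rewrite ltnn.
Qed.

Lemma gen_eq0 p a : deg a != p -> gen p a = 0.
Proof.
move=> ap; rewrite -(raddf0 (@cls X deg p)); congr cls; apply: hval_inj.
apply/funext => -[x|s u] //=.
by case: eqP => // ->; rewrite (negPf ap).
Qed.

(** A finite list containing all the words of length at most k (and longer ones);
    it may have repetitions. *)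
Fixpoint trees k : seq (tree X) :=
  if k is k'.+1 then [seq Leaf x | x <- enum X]
     ++ [seq Node s u | s <- trees k', u <- trees k'] else [::].

Lemma mem_trees k t : (tlen t <= k)%N -> t \in trees k.
Proof.
elim: k t => [|k IHk] t; first by rewrite leqNgt tlen_gt0.
rewrite mem_cat; case: t => [x|s u] /= le.
  by rewrite map_f ?mem_enum.
apply/orP/or_intror/allpairs_f; apply: IHk.
  by have := tlen_gt0 u; lia.
by have := tlen_gt0 s; lia.
Qed.

Lemma fil_mono_sum k p (x : L p) : x \in fil k ->
  exists c : tree X -> rat,
    x - \sum_(t <- undup (trees k) | tlen t == k) c t *: mono p t \in fil k.+1.
Proof.
move=> /filP[f <- fk]; exists (hval f).
pose m t : hseries deg p := HSeries (mono_homog p t).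
have cls_sum (P : pred (tree X)) ts : cls (\sum_(t <- ts | P t) hval f t *: m t)
    = \sum_(t <- ts | P t) hval f t *: mono p t.
  elim/big_rec2: _ => [|t x' y _ <-]; first exact: raddf0.
  by rewrite clsD cls_scale.
apply/filP; exists (f - \sum_(t <- undup (trees k) | tlen t == k) hval f t *: m t).
  by rewrite clsD clsN cls_sum.
move=> t tk.
have -> : hval (f - \sum_(t <- undup (trees k) | tlen t == k) hval f t *: m t) t
   = hval f t - hval (\sum_(t <- undup (trees k) | tlen t == k) hval f t *: m t) t.
  by [].
have mE s : (hval f s *: mono_series p s) t
    = hval f s * ((t == s) && (tdeg deg s == p))%:R by [].
have [tlk|ltk|tlk] := ltngtP (tlen t) k.
- rewrite fk // hval_sum big1 ?subr0// => s /eqP sk /=; rewrite mE.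
  by case: eqP => [ts|]; rewrite ?mulr0//; move: tlk; rewrite ts sk ltnn.
- by lia.
rewrite hval_sum (big_rem t) /=; last by rewrite mem_undup mem_trees// tlk.
rewrite tlk eqxx mE eqxx /= big_seq_cond big1 ?addr0; last first.
  move=> s /andP[sr _]; rewrite mE; case: eqP => [ts|]; last by rewrite mulr0.
  by move: sr; rewrite mem_rem_uniq ?undup_uniq// inE ts eqxx.
case: eqP => [_|/eqP tp]; first by rewrite mulr1 subrr.
rewrite mulr0 subr0; apply/eqP/contraT => /(homogP _ _ _ (hvalP f))/eqP.
by rewrite (negPf tp).
Qed.

Fact deg_subK r a : deg a + (r - deg a) = r.
Proof. by rewrite addrC subrK. Qed.

(** The general sum of brackets of generators with elements of the Lie algebra:
    the second factors form a family indexed by the generators. *)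
Definition genbr r (z : forall a, L (r - deg a)) : L r :=
  \sum_a bracket (deg_subK r a) (gen (deg a) a) (z a).

Lemma genbr_lin r c (z z' : forall a, L (r - deg a)) :
  genbr (fun a => c *: z a + z' a) = c *: genbr z + genbr z'.
Proof.
rewrite /genbr scaler_sumr -big_split; apply: eq_bigr => a _.
exact: (@bracket_linearr L).
Qed.

Lemma genbr_fil r k (z : forall a, L (r - deg a)) :
  (forall a, z a \in fil k) -> genbr z \in fil k.+1.
Proof.
move=> zk; apply: rpred_sum => a _; rewrite -add1n.
by apply: fil_bracket; rewrite ?fil1.
Qed.

Definition genspan k r (x : L r) :=
  exists2 z : forall a, L (r - deg a), forall a, z a \in fil k & x = genbr z.

Lemma genspan_lin k r c (x y : L r) :
  genspan k x -> genspan k y -> genspan k (c *: x + y).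
Proof.
move=> [z zk ->] [z' zk' ->]; exists (fun a => c *: z a + z' a).
  by move=> a; apply: rpredD; [exact/rpredZ/zk|exact: zk'].
by rewrite genbr_lin.
Qed.

Lemma genspan0 k r : genspan k (0 : L r).
Proof.
exists (fun=> 0) => [a|]; first by rewrite rpred0.
by rewrite /genbr big1 // => a _; rewrite (@bracket0r L).
Qed.

Lemma genspan_bracket k a q r (e : deg a + q = r) (z : L q) :
  z \in fil k -> genspan k (bracket e (gen (deg a) a) z).
Proof.
have qE : q = r - deg a by rewrite -e addrC addKr.
subst q => zk.
pose w b : L (r - deg b) :=
  if a =P b is ReflectT ab then ecast b (L (r - deg b)) ab z else 0.
have wa : w a = z.
  by rewrite /w; case: eqP => // e'; rewrite (eq_axiomK e').
exists w => [b|].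
  by rewrite /w; case: eqP => [ab|_]; [case: b / ab|rewrite rpred0].
rewrite /genbr (bigD1 a)//= big1 ?addr0; last first.
  move=> b ba; rewrite /w; case: eqP => [ab|_].
    by rewrite ab eqxx in ba.
  exact: (@bracket0r L).
by rewrite wa (eq_irrelevance e (deg_subK r a)).
Qed.

(** By the Jacobi identity, [[s, u], v] = [s, [u, v]] - (-1)^(|s| |u|) [u, [s, v]],
    and the words s and u are shorter than [s, u]. *)
Lemma genspan_mono k t q r (e : tdeg deg t + q = r) (v : L q) :
  (0 < k)%N -> v \in fil k ->
  genspan (k + tlen t).-1 (bracket e (mono (tdeg deg t) t) v).
Proof.
move=> k0 vk; elim: t => [a|s IHs u IHu] in k q r e v k0 vk *.
  by rewrite addn1 mono_leaf; apply: genspan_bracket.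
have esu : tdeg deg u + q = tdeg deg u + q by [].
have ess : tdeg deg s + q = tdeg deg s + q by [].
have f2 : tdeg deg s + (tdeg deg u + q) = r by rewrite addrA.
have f3 : tdeg deg u + (tdeg deg s + q) = r by rewrite addrCA addrA.
have -> : bracket e (mono (tdeg deg (Node s u)) (Node s u)) v =
    bracket f2 (mono _ s) (bracket esu (mono _ u) v)
    - (-1) ^ (tdeg deg s * tdeg deg u)
      *: bracket f3 (mono _ u) (bracket ess (mono _ s) v).
  rewrite (bracket_jacobi erefl esu ess e f2 f3 (mono _ s) (mono _ u) v) addrK.
  by rewrite -(mono_node erefl erefl erefl).
rewrite addrC -scaleNr.
have -> : (k + tlen (Node s u)).-1 = (tlen s + k + tlen u).-1 by rewrite /=; lia.
apply: genspan_lin.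
  by apply: IHu; [lia|apply: fil_bracket (fil_mono _ _) vk].
have -> : (tlen s + k + tlen u).-1 = (tlen u + k + tlen s).-1 by lia.
by apply: IHs; [lia|apply: fil_bracket (fil_mono _ _) vk].
Qed.

Lemma fil_genspan_step k r (x : L r) : x \in fil k.+2 ->
  exists2 z : forall a, L (r - deg a), forall a, z a \in fil k.+1
    & x - genbr z \in fil k.+3.
Proof.
move=> /fil_mono_sum[c]; set y := \sum_(_ <- _ | _) _ => xy.
suff [z zk yE] : genspan k.+1 y by exists z => //; rewrite -yE.
apply: big_ind => [|y1 y2 y1s y2s|t /eqP tk]; first exact: genspan0.
  by rewrite -[y1]scale1r; apply: genspan_lin.
rewrite -[_ *: _]addr0; apply: genspan_lin; last exact: genspan0.
have [tr|tr] := eqVneq (tdeg deg t) r; last first.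
  suff -> : mono r t = 0 by exact: genspan0.
  rewrite -(raddf0 (@cls X deg r)); congr cls; apply: hval_inj.
  apply/funext => t' /=; rewrite /mono_series.
  by rewrite (negPf tr) andbF.
case: t tk tr => [//|s u] /= tk tr; rewrite (mono_node tr erefl erefl).
have -> : k.+1 = (tlen u + tlen s).-1 by lia.
by apply: genspan_mono (fil_mono _ _); apply: tlen_gt0.
Qed.

(** This is an exact equality, without closure: the remainders of the successive
    approximations by [fil_genspan_step] are summed inside each of the finitely
    many second factors. *)
Lemma fil_genspan k r (x : L r) : (0 < k)%N -> x \in fil k.+1 -> genspan k x.
Proof.
case: k => // k _ xk.
have step j (y : L r) : {z : forall a, L (r - deg a) | y \in fil j.+2 ->
    (forall a, z a \in fil j.+1) /\ y - genbr z \in fil j.+3}.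
  apply: cid; have [yj|_] := boolP (y \in fil j.+2); last by exists (fun=> 0).
  by have [z zj yz] := fil_genspan_step yj; exists z.
(* rest i is what remains of x after i steps, z i the second factors of step i. *)
pose rest := fix rest i := if i is i'.+1
  then rest i' - genbr (sval (step (k + i')%N (rest i'))) else x.
pose z i := sval (step (k + i)%N (rest i)).
have restP i : rest i \in fil (k + i).+2.
  elim: i => [|i IHi] /=; first by rewrite addn0.
  by rewrite addnS; apply: (proj2 (svalP (step _ _) IHi)).
have zP i a : z i a \in fil (k + i).+1.
  exact: (proj1 (svalP (step _ _) (restP i))).
have Zex a : {y : L (r - deg a) | forall i, y - \sum_(l < i) z l a \in fil i}.
  apply/cid/fil_complete => i; rewrite big_ord_recr /= addrAC subrr add0r.
  by apply: filW (zP i a); lia.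
pose Z a := sval (Zex a); have ZP a := svalP (Zex a).
have restE i : x = rest i + genbr (fun a => \sum_(l < i) z l a).
  elim: i => [|i IHi].
    rewrite /= /genbr big1 ?addr0// => a _.
    by rewrite big_ord0 (@bracket0r L).
  have -> : (fun a => \sum_(l < i.+1) z l a) =
      (fun a => 1 *: z i a + \sum_(l < i) z l a).
    by apply/functional_extensionality_dep => a; rewrite big_ord_recr /= scale1r addrC.
  by rewrite genbr_lin scale1r addrA /= subrK -IHi.
exists Z => [a|].
  rewrite -[Z a](subrK (\sum_(l < k.+1) z l a)).
  apply: rpredD; first exact: ZP.
  by apply: rpred_sum => l _; apply: filW (zP l a); lia.
apply/eqP; rewrite -subr_eq0; apply/eqP/fil_separated => i.
rewrite (restE i) -addrA; apply: rpredD; first by apply: filW (restP i); lia.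
have := genbr_lin (-1) Z (fun a => \sum_(l < i) z l a).
rewrite scaleN1r addrC => <-; apply: filW (leqnSn i) _; apply: genbr_fil => a.
by rewrite scaleN1r -rpredN opprD opprK; apply: ZP.
Qed.

Lemma fil_gens p (x : L p) :
  exists c : X -> rat, x - \sum_a c a *: gen p a \in fil 2.
Proof.
pose c a := hval (repr x) (Leaf a); exists c.
have clsE : cls (repr x - \sum_a c a *: HSeries (gen_homog deg p a))
    = x - \sum_a c a *: gen p a.
  rewrite clsD clsN cls_repr; congr (_ - _).
  elim/big_rec2: _ => [|a y' y _ <-]; first exact: raddf0.
  by rewrite clsD cls_scale.
apply/filP; eexists; first exact: clsE.
case=> [a _|s u /= lt]; last by move: lt; have := tlen_gt0 s; have := tlen_gt0 u; lia.
set S := \sum_a _.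
have -> : hval (repr x - S) (Leaf a) = hval (repr x) (Leaf a) - hval S (Leaf a).
  by [].
have cE b : hval (c b *: HSeries (gen_homog deg p b)) (Leaf a)
  = c b * ((a == b) && (deg a == p))%:R by [].
have -> : hval S (Leaf a) = c a * (deg a == p)%:R.
  rewrite hval_sum (bigD1 a)// big1 => [|b /andP[_ ba]].
    by rewrite cE eqxx; exact: addr0.
  by rewrite cE eq_sym (negPf ba) mulr0.
case: eqP => [_|/eqP ap]; first by rewrite mulr1; exact: subrr.
rewrite mulr0 subr0; apply/eqP/contraT => /(homogP _ _ _ (hvalP (repr x)))/eqP.
by rewrite /= (negPf ap).
Qed.

(** [fil_genspan] as an induction principle: closure of P under finite sums is
    enough to reach every element, although elements are infinite series. *)
Lemma fil_ind k r (P : L r -> Prop) : (0 < k)%N ->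
  P 0 -> (forall x y, P x -> P y -> P (x + y)) ->
  (forall a q (e : deg a + q = r) (z : L q), z \in fil k ->
    P (bracket e (gen (deg a) a) z)) ->
  forall x, x \in fil k.+1 -> P x.
Proof.
move=> k0 P0 PD Pb x /(fil_genspan k0)[z zk ->].
by apply: big_ind => // a _; apply: Pb.
Qed.

End Span.

(** * Continuity of derivations and morphisms *)

Section Additivity.
Variables L M : gradedLie.
Implicit Types (f : lieHom L M) (D : differential L) (p : int).

Lemma lhomB f p (x y : L p) : f p (x - y) = f p x - f p y.
Proof. exact: linearB. Qed.

Lemma lhomD f p (x y : L p) : f p (x + y) = f p x + f p y.
Proof. exact: linearD. Qed.

Lemma lhomN f p (x : L p) : f p (- x) = - f p x.
Proof. exact: linearN. Qed.

Lemma lhomZ f p a (x : L p) : f p (a *: x) = a *: f p x.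
Proof. exact: linearZ. Qed.

Lemma lhom0 f p : f p 0 = 0.
Proof. exact: linear0. Qed.

Lemma lhom_sum f p (I : finType) (P : pred I) (F : I -> L p) :
  f p (\sum_(i | P i) F i) = \sum_(i | P i) f p (F i).
Proof. exact: linear_sum. Qed.

Lemma dfunB D p (x y : L p) : D p (x - y) = D p x - D p y.
Proof. exact: linearB. Qed.

Lemma dfunD D p (x y : L p) : D p (x + y) = D p x + D p y.
Proof. exact: linearD. Qed.

Lemma dfunN D p (x : L p) : D p (- x) = - D p x.
Proof. exact: linearN. Qed.

Lemma dfunZ D p a (x : L p) : D p (a *: x) = a *: D p x.
Proof. exact: linearZ. Qed.

Lemma dfun0 D p : D p 0 = 0.
Proof. exact: linear0. Qed.

Lemma dfun_sum D p (I : finType) (P : pred I) (F : I -> L p) :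
  D p (\sum_(i | P i) F i) = \sum_(i | P i) D p (F i).
Proof. exact: linear_sum. Qed.
End Additivity.

Section Growth.
Variables (X Y : finType) (degX : X -> int) (degY : Y -> int).
Local Notation L := (freeLie degX).
Local Notation M := (freeLie degY).
Implicit Types (p q r : int) (k : nat).

(** A family of linear maps that behaves on brackets like a derivation, and raises
    the filtration by m on the generators, raises it by m everywhere.  It
    applies to morphisms, derivations, differences of morphisms, and
    commutators of a morphism with differentials.  Continuity is part
    of the conclusion: that Delta maps [fil k] into [fil (min (m + k) N)] is proved by
    induction on N, because each bracket with a generator gains one step. *)
Lemma fil_growth (h : int -> int) (Delta : forall p, L p -> M (h p)) (m : nat) :
  (forall p a x y, Delta p (a *: x + y) = a *: Delta p x + Delta p y) ->
  (forall a, Delta (degX a) (gen degX (degX a) a) \in fil m.+1) ->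
  (forall a p r (e : degX a + p = r) (z : L p) j i,
    z \in fil j -> Delta p z \in fil i ->
    Delta r (bracket e (gen degX (degX a) a) z) \in fil (minn (m.+1 + j) i.+1)) ->
  forall k p (x : L p), x \in fil k.+1 -> Delta p x \in fil (m + k.+1).
Proof.
move=> Dlin Dgen Dbr.
have DD p x y : Delta p (x + y) = Delta p x + Delta p y.
  by have := Dlin p 1 x y; rewrite !scale1r.
have D0 p : Delta p 0 = 0 by apply: (addrI (Delta p 0)); rewrite -DD !addr0.
have main N k p (x : L p) : x \in fil k.+1 -> Delta p x \in fil (minn (m + k.+1) N).
  elim: N k p x => [|N IHN] k p x xk.
    by rewrite minn0; apply: filW (fil1 _).
  have br l y : y \in fil l.+2 -> Delta p y \in fil (minn (m + l.+2) N.+1).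
    apply: (fil_ind (P := fun y => Delta p y \in fil (minn (m + l.+2) N.+1))) => //.
    - by rewrite D0 rpred0.
    - by move=> u v uP vP; rewrite DD rpredD.
    - move=> a q e z zl; have zN := IHN _ _ _ zl.
      by apply: filW (Dbr _ _ _ e _ _ _ zl zN); lia.
  case: k xk => [_|k]; last exact: br.
  (* On [fil 1] the part of length one, a combination of generators, is split off. *)
  have [c cx] := fil_gens x.
  rewrite -(subrK (\sum_a c a *: gen degX p a) x) DD rpredD//.
    by apply: filW (br 0%N _ cx); lia.
  apply: (big_ind (fun y => Delta p y \in fil (minn (m + 1) N.+1))).
  - by rewrite D0 rpred0.
  - by move=> u v uP vP; rewrite DD rpredD.
  - move=> a _; rewrite -[_ *: _]addr0 Dlin D0 addr0 rpredZ//.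
    have [<-|ap] := eqVneq (degX a) p; first by apply: filW (Dgen a); lia.
    by rewrite gen_eq0// D0 rpred0.
move=> k p x /(main (m + k.+1)%N); by rewrite minnn.
Qed.
End Growth.

Section Morphisms.
Variables (X Y : finType) (degX : X -> int) (degY : Y -> int).
Local Notation L := (freeLie degX).
Local Notation M := (freeLie degY).
Implicit Types (f g : lieHom L M) (p q r : int) (k : nat).

Lemma lieHom_fil f k p (x : L p) : x \in fil k -> f p x \in fil k.
Proof.
case: k => [_|k]; first exact: filW (fil1 _).
apply: (@fil_growth _ _ _ _ id (fun p => f p) 0) => {k p x}.
- by move=> p a x y; rewrite linearP.
- by move=> a; apply: fil1.
move=> a p r e z j i zj fz; rewrite lhom_bracket.
have := fil_bracket e (fil1 (f _ (gen degX (degX a) a))) fz.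
by apply: filW; lia.
Qed.

Lemma lieHom_close f g m k p (x : L p) :
  (forall a, f (degX a) (gen degX (degX a) a) - g (degX a) (gen degX (degX a) a)
     \in fil m.+1) ->
  x \in fil k.+1 -> f p x - g p x \in fil (m + k.+1).
Proof.
move=> fg; apply: (@fil_growth _ _ _ _ id (fun p x => f p x - g p x) m) => // {k p x}.
  by move=> p a x y; rewrite (linearP (f p)) (linearP (g p)) scalerBr opprD addrACA.
move=> a p r e z j i zj dz; rewrite !lhom_bracket.
set u := f _ _; set v := g _ _.
have -> : bracket e u (f p z) - bracket e v (g p z)
    = bracket e (u - v) (f p z) + bracket e v (f p z - g p z).
  by rewrite bracketBl bracketBr addrA subrK.
apply: rpredD.
  by apply: filW (fil_bracket e (fg a) (lieHom_fil f zj)); lia.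
by apply: filW (fil_bracket e (fil1 v) dz); lia.
Qed.

Lemma lieHom_ext f g :
  (forall a, f (degX a) (gen degX (degX a) a) = g (degX a) (gen degX (degX a) a)) ->
  forall p x, f p x = g p x.
Proof.
move=> fg p x; apply/eqP; rewrite -subr_eq0; apply/eqP/fil_separated => k.
apply: filW (lieHom_close (m := k) _ (fil1 x)); first by lia.
by move=> a; rewrite fg subrr rpred0.
Qed.

Lemma differential_fil (D : differential L) k p (x : L p) :
  x \in fil k -> D p x \in fil k.
Proof.
case: k => [_|k]; first exact: filW (fil1 _).
apply: (@fil_growth _ _ _ _ (fun p => p - 1) (fun p => D p) 0) => {k p x}.
- by move=> p a x y; rewrite linearP.
- by move=> a; apply: fil1.
move=> a p r e z j i zj fz.
have el : degX a - 1 + p = r - 1 by rewrite -e addrAC.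
have er : degX a + (p - 1) = r - 1 by rewrite -e addrA.
rewrite (dfun_derivation D e el er); apply: rpredD.
  by apply: filW (fil_bracket el (fil1 _) zj); lia.
by apply/rpredZ/(filW _ (fil_bracket er (fil1 _) fz)); lia.
Qed.

(** Measures how far f is from commuting with differentials: the defect
    satisfies the Leibniz rule with respect to f, hence is controlled by its
    values on the generators. *)
Lemma commutator_fil (D : differential L) (E : differential M) f m :
  (forall a, f _ (D _ (gen degX (degX a) a)) - E _ (f _ (gen degX (degX a) a))
     \in fil m.+1) ->
  forall k p (x : L p), x \in fil k.+1 ->
    f _ (D p x) - E p (f p x) \in fil (m + k.+1).
Proof.
move=> fD k p x.
apply: (@fil_growth _ _ _ _ (fun p => p - 1)
  (fun p x => f _ (D p x) - E p (f p x)) m) => // {k p x}.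
  move=> p a x y; rewrite (linearP (D p)) (linearP (f p)) (linearP (E p)).
  by rewrite (linearP (f _)) scalerBr opprD addrACA.
move=> a p r e z j i zj dz.
have el : degX a - 1 + p = r - 1 by rewrite -e addrAC.
have er : degX a + (p - 1) = r - 1 by rewrite -e addrA.
rewrite (dfun_derivation D e el er) linearD linearZ /= !lhom_bracket.
rewrite (dfun_derivation E e el er) opprD addrACA -(@bracketBl M).
rewrite -scalerBr -(@bracketBr M).
apply: rpredD.
  by apply: filW (fil_bracket el (fD a) (lieHom_fil f zj)); lia.
by apply/rpredZ/(filW _ (fil_bracket er (fil1 _) dz)); lia.
Qed.

Lemma dgl_hom_gen (D : differential L) (E : differential M) f :
  (forall a, f _ (D _ (gen degX (degX a) a)) = E _ (f _ (gen degX (degX a) a))) ->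
  is_dgl_hom D E f.
Proof.
move=> fD p x; apply/eqP; rewrite -subr_eq0; apply/eqP/fil_separated => k.
apply: filW (commutator_fil (m := k) _ (fil1 x)); first by lia.
by move=> a; rewrite fD subrr rpred0.
Qed.
End Morphisms.

(** * Morphisms and derivations with given values on the generators *)

Section Substitution.
Variables (X Y : finType) (degX : X -> int) (degY : Y -> int).
Variable g : X -> tree Y -> rat^o.
Hypothesis g_homog : forall a, g a \in homog degY (degX a).

(** The coefficient at t of the series f in which each leaf a is replaced by the
    series g a.  The words contributing to it either are a single leaf a, with
    g a contributing t, or split along the root of t, which makes the sum a
    recursion on t. *)
Fixpoint substc (t : tree Y) (f : tree X -> rat^o) : rat :=
  \sum_a f (Leaf a) * g a t +
  match t with
  | Leaf _ => 0
  | Node s u => substc s (fun v => substc u (fun w => f (Node v w)))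
  end.

Definition subst (f : tree X -> rat^o) : tree Y -> rat^o := fun t => substc t f.

Lemma substcL y f : substc (Leaf y) f = \sum_a f (Leaf a) * g a (Leaf y).
Proof. exact: addr0. Qed.

Lemma substcN s u f : substc (Node s u) f = \sum_a f (Leaf a) * g a (Node s u) +
  substc s (fun v => substc u (fun w => f (Node v w))).
Proof. by []. Qed.

Lemma substcD t c (f f' : tree X -> rat^o) :
  substc t (fun s => c * f s + f' s) = c * substc t f + substc t f'.
Proof.
have lD F F' s : \sum_a (c * F (Leaf a) + F' (Leaf a)) * g a s
    = c * (\sum_a F (Leaf a) * g a s) + \sum_a F' (Leaf a) * g a s.
  by rewrite mulr_sumr -big_split /=; apply: eq_bigr => a _; rewrite mulrDl mulrA.
elim: t f f' => [y|s IHs u IHu] f f'.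
  by rewrite !substcL (lD f f').
rewrite !substcN (lD f f') mulrDr addrACA; congr (_ + _); rewrite -IHs.
by congr substc; apply/funext => v; apply: IHu.
Qed.

Lemma substc0 t (f : tree X -> rat^o) : (forall s, f s = 0) -> substc t f = 0.
Proof.
move=> f0; have -> : f = 0 by apply/funext.
by have := substcD t (-1) 0 0; rewrite mulN1r addNr => <-; congr substc;
  apply/funext => s; rewrite mulr0 addr0.
Qed.

Lemma substcZ t c (f : tree X -> rat^o) :
  substc t (fun s => c * f s) = c * substc t f.
Proof.
have := substcD t c f 0; rewrite (@substc0 t 0) // addr0 => <-.
by congr substc; apply/funext => s; rewrite addr0.
Qed.

Lemma subst_linear c f f' : subst (c *: f + f') = c *: subst f + subst f'.
Proof. by apply/funext => t; apply: substcD. Qed.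

Lemma subst_mbr f f' : subst (mbr f f') = mbr (subst f) (subst f').
Proof.
apply/funext => -[y|s u]; rewrite /subst ?(substcL, substcN) big1 ?add0r//;
  try by move=> a _; rewrite mul0r.
rewrite -[RHS]/((substc s f : rat) * substc u f') mulrC -substcZ.
congr substc; apply/funext => v; rewrite mulrC -substcZ.
by [].
Qed.

Lemma substc_homog p t f : f \in homog degX p -> tdeg degY t != p ->
  substc t f = 0.
Proof.
have leaf0 p' f' t' a : f' \in homog degX p' -> tdeg degY t' != p' ->
    f' (Leaf a) * g a t' = 0.
  move=> f'p t'p; have [->|/(homogP _ _ _ f'p) fa] := eqVneq (f' (Leaf a)) 0.
    by rewrite mul0r.
  have [->|/(homogP _ _ _ (g_homog a)) ga] := eqVneq (g a t') 0.
    by rewrite mulr0.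
  by rewrite ga -fa eqxx in t'p.
elim: t p f => [y|s IHs u IHu] p f fp tp.
  by rewrite substcL big1// => a _; apply: leaf0 tp.
rewrite substcN big1 ?add0r => [|a _]; last exact: leaf0 tp.
apply: (IHs (p - tdeg degY u)); last first.
  by apply: contra_neq tp => /= ->; rewrite subrK.
apply/homogP => v; apply: contra_neqP => /eqP vp; apply: (IHu (p - tdeg degX v)).
  by apply/homogP => w /(homogP _ _ _ fp) /= <-; rewrite addrC addKr.
by apply: contra_neq vp => ->; rewrite opprB addrC subrK.
Qed.

Lemma subst_homog p f : f \in homog degX p -> subst f \in homog degY p.
Proof.
move=> fp; apply/homogP => t; apply: contra_neqP => /eqP; exact: substc_homog.
Qed.

(** Substitution does not shorten words, so it is continuous. *)
Lemma substc_agree t f f' :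
  (forall s, (tlen s <= tlen t)%N -> f s = f' s) -> substc t f = substc t f'.
Proof.
elim: t f f' => [y|s IHs u IHu] f f' ff'.
  by rewrite !substcL; apply: eq_bigr => a _; rewrite ff'.
rewrite !substcN; congr (_ + _).
  by apply: eq_bigr => a _; rewrite ff'// tlen_gt0.
by apply: IHs => v vs; apply: IHu => w wu; apply: ff'; apply: leq_add.
Qed.

Lemma lieIdeal_subst p f : lieIdeal degX p f -> lieIdeal degY p (subst f).
Proof.
have subst0 : subst 0 = 0 by apply/funext => t; apply: substc0.
have substZ a h : subst (a *: h) = a *: subst h.
  by rewrite -[a *: h]addr0 subst_linear subst0 addr0.
have substD h h' : subst (h + h') = subst h + subst h'.
  by have := subst_linear 1 h h'; rewrite !scale1r.
have substN h : subst (- h) = - subst h by rewrite -scaleN1r substZ scaleN1r.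
elim=> {p f}.
- by move=> p; rewrite subst0; apply: LieIdeal0.
- by move=> p a f f' _ IHf _ IHf'; rewrite subst_linear; apply: LieIdealD.
- move=> p q f f' fp f'q; rewrite substD substZ !subst_mbr.
  by apply: LieIdealAntisym; apply: subst_homog.
- move=> p q r f f' h fp f'q hr; rewrite !(substD, substN) substZ !subst_mbr.
  by apply: LieIdealJacobi; apply: subst_homog.
- move=> p q f f' fp _ IHf'; rewrite subst_mbr.
  by apply: LieIdealMull => //; apply: subst_homog.
- move=> p q f f' _ IHf f'q; rewrite subst_mbr.
  by apply: LieIdealMulr => //; apply: subst_homog.
Qed.

Definition hsubst p (f : hseries degX p) : hseries degY p :=
  HSeries (subst_homog (hvalP f)).

Definition freeLie_subst p (x : freeLie degX p) : freeLie degY p :=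
  cls (hsubst (repr x)).

Lemma freeLie_substE p (f : hseries degX p) :
  freeLie_subst (cls f) = cls (hsubst f).
Proof.
apply/cls_eq/lieRelP => n; have /lieRelP/(_ n)[h Ih fh] := lieRel_repr f.
exists (subst h); first exact: lieIdeal_subst.
move=> t tn; have -> : subst h t = subst (hval (repr (cls f)) - hval f) t.
  by apply: substc_agree => s st; rewrite -fh//; apply: leq_trans tn.
have := subst_linear (-1) (hval f) (hval (repr (cls f))).
by rewrite !scaleN1r ![- _ + _]addrC => ->.
Qed.

Fact freeLie_subst_linear p : linear (@freeLie_subst p).
Proof.
move=> a x y; rewrite -[x]cls_repr -[y]cls_repr -cls_linear !freeLie_substE.
rewrite -cls_linear; congr cls; apply: hval_inj; exact: subst_linear.
Qed.
HB.instance Definition _ p :=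
  GRing.isLinear.Build rat (freeLie degX p) (freeLie degY p) *:%R
    (@freeLie_subst p) (@freeLie_subst_linear p).

Fact freeLie_subst_bracket p q r (e : p + q = r)
    (x : freeLie degX p) (y : freeLie degX q) :
  freeLie_subst (bracket e x y) = bracket e (freeLie_subst x) (freeLie_subst y).
Proof.
rewrite /freeLie /= -[x]cls_repr -[y]cls_repr freeLie_bracketE !freeLie_substE.
rewrite freeLie_bracketE; congr cls; apply: hval_inj; exact: subst_mbr.
Qed.

Definition freeLie_subst_hom : lieHom (freeLie degX) (freeLie degY) :=
  @LieHom (freeLie degX) (freeLie degY)
    (fun p => @freeLie_subst p : {linear _ -> _}) freeLie_subst_bracket.

Lemma freeLie_subst_gen a : freeLie_subst_hom _ (gen degX (degX a) a) =
  cls (HSeries (g_homog a)).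
Proof.
rewrite /gen /= freeLie_substE; congr cls; apply: hval_inj.
have genE t : \sum_b gen_series degX (degX a) a (Leaf b) * g b t = g a t.
  rewrite (bigD1 a)//= !eqxx mul1r big1 ?addr0// => b /negPf ba.
  by rewrite ba mul0r.
apply/funext => -[y|s u]; first exact: etrans (substcL _ _) (genE _).
apply: etrans (substcN _ _ _) _; rewrite genE substc0; first exact: addr0.
by move=> v; apply: substc0.
Qed.
End Substitution.

(** The universal property of the completed free Lie algebra, as far as morphisms
    to another such algebra are concerned. *)
Lemma freeLie_lift (X Y : finType) (degX : X -> int) (degY : Y -> int)
    (y : forall a, freeLie degY (degX a)) :
  {f : lieHom (freeLie degX) (freeLie degY) |
    forall a, f _ (gen degX (degX a) a) = y a}.
Proof.
exists (freeLie_subst_hom (fun a => hvalP (repr (y a)))) => a.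
rewrite freeLie_subst_gen -[RHS]cls_repr; congr cls; exact: hval_inj.
Qed.

Section Derivation.
Variables (X : finType) (deg : X -> int) (d : int).
Variable th : X -> tree X -> rat^o.
Hypothesis th_homog : forall a, th a \in homog deg (deg a + d).

(** The coefficient at t of the image of f under the derivation of degree d which
    extends a |-> th a.  As in [substc] the recursion follows t: below the root
    the derivation acts on exactly one of the two factors, with a Koszul sign
    when it passes the left one. *)
Fixpoint derc (t : tree X) (f : tree X -> rat^o) : rat :=
  \sum_a f (Leaf a) * th a t +
  match t with
  | Leaf _ => 0
  | Node s u => derc s (fun v => f (Node v u))
      + (-1) ^ (d * tdeg deg s) * derc u (fun w => f (Node s w))
  end.

Definition der (f : tree X -> rat^o) : tree X -> rat^o := fun t => derc t f.

Lemma dercL y f : derc (Leaf y) f = \sum_a f (Leaf a) * th a (Leaf y).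
Proof. exact: addr0. Qed.

Lemma dercN s u f : derc (Node s u) f = \sum_a f (Leaf a) * th a (Node s u) +
  (derc s (fun v => f (Node v u))
   + (-1) ^ (d * tdeg deg s) * derc u (fun w => f (Node s w))).
Proof. by []. Qed.

Lemma dercD t c (f f' : tree X -> rat^o) :
  derc t (fun s => c * f s + f' s) = c * derc t f + derc t f'.
Proof.
have lD F F' s : \sum_a (c * F (Leaf a) + F' (Leaf a)) * th a s
    = c * (\sum_a F (Leaf a) * th a s) + \sum_a F' (Leaf a) * th a s.
  by rewrite mulr_sumr -big_split /=; apply: eq_bigr => a _; rewrite mulrDl mulrA.
elim: t f f' => [y|s IHs u IHu] f f'.
  by rewrite !dercL (lD f f').
rewrite !dercN (lD f f') IHs IHu; ring.
Qed.

Lemma derc0 t (f : tree X -> rat^o) : (forall s, f s = 0) -> derc t f = 0.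
Proof.
move=> f0; have -> : f = 0 by apply/funext.
by have := dercD t (-1) 0 0; rewrite mulN1r addNr => <-; congr derc;
  apply/funext => s; rewrite mulr0 addr0.
Qed.

Lemma dercZ t c (f : tree X -> rat^o) :
  derc t (fun s => c * f s) = c * derc t f.
Proof.
have := dercD t c f 0; rewrite (@derc0 t 0) // addr0 => <-.
by congr derc; apply/funext => s; rewrite addr0.
Qed.

Lemma der_linear c f f' : der (c *: f + f') = c *: der f + der f'.
Proof. by apply/funext => t; apply: dercD. Qed.

Lemma der_mbr p f f' : f \in homog deg p ->
  der (mbr f f') = mbr (der f) f' + (-1) ^ (d * p) *: mbr f (der f').
Proof.
move=> fp; apply/funext => -[y|s u]; rewrite /der.
  rewrite dercL big1 => [|a _]; last by rewrite mul0r.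
  by apply/esym; rewrite -[LHS]/(0 + (-1) ^ (d * p) * 0) mulr0 addr0.
rewrite dercN big1 ?add0r => [|a _]; last by rewrite mul0r.
rewrite -[RHS]/((derc s f : rat) * f' u + (-1) ^ (d * p) * (f s * derc u f')).
rewrite /= dercZ; congr (_ + _).
  by rewrite mulrC -dercZ; congr derc; apply/funext => v; apply: mulrC.
have [->|/(homogP _ _ _ fp) ->//] := eqVneq (f s) 0.
by rewrite mul0r !mulr0.
Qed.

Lemma derc_homog p t f : f \in homog deg p -> tdeg deg t != p + d ->
  derc t f = 0.
Proof.
have leaf0 p' f' t' a : f' \in homog deg p' -> tdeg deg t' != p' + d ->
    f' (Leaf a) * th a t' = 0.
  move=> f'p t'p; have [->|/(homogP _ _ _ f'p) fa] := eqVneq (f' (Leaf a)) 0.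
    by rewrite mul0r.
  have [->|/(homogP _ _ _ (th_homog a)) ga] := eqVneq (th a t') 0.
    by rewrite mulr0.
  by rewrite ga -fa eqxx in t'p.
elim: t p f => [y|s IHs u IHu] p f fp tp.
  by rewrite dercL big1// => a _; apply: leaf0 tp.
rewrite dercN big1 ?add0r => [|a _]; last exact: leaf0 tp.
rewrite (IHs (p - tdeg deg u)) ?(IHu (p - tdeg deg s)) ?mulr0 ?addr0 //.
- by apply/homogP => w /(homogP _ _ _ fp) /= <-; rewrite addrC addKr.
- by apply: contra_neq tp => /= ->; ring.
- by apply/homogP => v /(homogP _ _ _ fp) /= <-; rewrite addrK.
- by apply: contra_neq tp => /= ->; ring.
Qed.

Lemma der_homog p f : f \in homog deg p -> der f \in homog deg (p + d).
Proof.
move=> fp; apply/homogP => t; apply: contra_neqP => /eqP; exact: derc_homog.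
Qed.

Lemma derc_agree t f f' :
  (forall s, (tlen s <= tlen t)%N -> f s = f' s) -> derc t f = derc t f'.
Proof.
elim: t f f' => [y|s IHs u IHu] f f' ff'.
  by rewrite !dercL; apply: eq_bigr => a _; rewrite ff'.
rewrite !dercN; congr (_ + (_ + _ * _)).
- by apply: eq_bigr => a _; rewrite ff'// tlen_gt0.
- by apply: IHs => v vs; apply: ff'; rewrite /= leq_add2r.
- by apply: IHu => v vs; apply: ff'; rewrite /= leq_add2l.
Qed.

Lemma mbr_homogD p q f g : f \in homog deg p -> g \in homog deg q ->
  mbr f g \in homog deg (p + q).
Proof. by move=> fp gq; exact: (mbr_homog erefl (HSeries fp) (HSeries gq)). Qed.

Lemma lieIdeal_homog p f : lieIdeal deg p f -> f \in homog deg p.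
Proof.
elim=> {p f}.
- by move=> p; apply: rpred0.
- by move=> p a f g _ fp _ gp; rewrite rpredD// rpredZ.
- move=> p q f g fp gq; apply: rpredD; first exact: mbr_homogD.
  by apply: rpredZ; rewrite addrC; apply: mbr_homogD.
- move=> p q r f g h fp gq hr; apply: rpredB; first apply: rpredB.
  + by rewrite -addrA; apply/mbr_homogD/mbr_homogD.
  + by apply: mbr_homogD => //; apply: mbr_homogD.
  + by apply: rpredZ; rewrite -addrA addrCA; apply/mbr_homogD/mbr_homogD.
- by move=> p q f g fp _ gq; apply: mbr_homogD.
- by move=> p q f g _ fp gq; apply: mbr_homogD.
Qed.

(** The image of an antisymmetry or Jacobi relator is a combination of relators of
    the same kind, obtained by applying the derivation to one argument at a
    time. *)
Lemma lieIdeal_der p f : lieIdeal deg p f -> lieIdeal deg (p + d) (der f).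
Proof.
have der0 : der 0 = 0 by apply/funext => t; apply: derc0.
have derZ a h : der (a *: h) = a *: der h.
  by rewrite -[a *: h]addr0 der_linear der0 addr0.
have derD h h' : der (h + h') = der h + der h'.
  by have := der_linear 1 h h'; rewrite !scale1r.
have derN h : der (- h) = - der h by rewrite -scaleN1r derZ scaleN1r.
have IdD p1 h h' : lieIdeal deg p1 h -> lieIdeal deg p1 h' -> lieIdeal deg p1 (h + h').
  by move=> ? ?; rewrite -[h]scale1r; apply: LieIdealD.
have IdZ p1 a h : lieIdeal deg p1 h -> lieIdeal deg p1 (a *: h).
  by move=> ?; rewrite -[_ *: _]addr0; apply: LieIdealD => //; apply: LieIdeal0.
have sgn2 n : ((-1) ^ n * (-1) ^ n = 1 :> rat).
  by rewrite -expfzMl mulrNN mulr1 exp1rz.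
have sgnD m n : ((-1) ^ (m + n) = (-1) ^ m * (-1) ^ n :> rat).
  by rewrite expfzDr.
elim=> {p f}.
- by move=> p; rewrite der0; apply: LieIdeal0.
- by move=> p a f f' _ IHf _ IHf'; rewrite der_linear; apply: LieIdealD.
- move=> p q f g fp gq; rewrite derD derZ (der_mbr _ fp) (der_mbr _ gq).
  have -> : mbr (der f) g + (-1) ^ (d * p) *: mbr f (der g)
        + (-1) ^ (p * q) *: (mbr (der g) f + (-1) ^ (d * q) *: mbr g (der f))
      = (mbr (der f) g + (-1) ^ ((p + d) * q) *: mbr g (der f))
        + (-1) ^ (d * p) *: (mbr f (der g) + (-1) ^ (p * (q + d)) *: mbr (der g) f).
    rewrite mulrDl mulrDr !sgnD [p * d]mulrC; apply/funext => t.
    have alg (a1 a2 a3 a4 c x y : rat) : x * x = 1 ->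
        a1 + x * a2 + c * (a3 + y * a4)
        = a1 + c * y * a4 + x * (a2 + c * x * a3).
      move=> xx; have -> : x * (a2 + c * x * a3) = x * a2 + c * a3.
        by rewrite -[c * a3]mul1r -xx; ring.
      by ring.
    by rewrite [d * q]mulrC; apply: alg; apply: sgn2.
  apply: IdD.
    by rewrite addrAC; apply: LieIdealAntisym => //; apply: der_homog.
  by apply: IdZ; rewrite -addrA; apply: LieIdealAntisym => //; apply: der_homog.
- move=> p q r f g h fp gq hr; rewrite !(derD, derN) derZ.
  have fgpq : mbr f g \in homog deg (p + q).
    exact: mbr_homogD.
  rewrite !(der_mbr _ fp) !(der_mbr _ gq) (der_mbr _ fgpq) !(der_mbr _ fp).
  have -> : (mbr (der f) (mbr g h)
      + (-1) ^ (d * p) *: mbr f (mbr (der g) h + (-1) ^ (d * q) *: mbr g (der h))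
      - (mbr (mbr (der f) g + (-1) ^ (d * p) *: mbr f (der g)) h
         + (-1) ^ (d * (p + q)) *: mbr (mbr f g) (der h))
      - (-1) ^ (p * q) *: (mbr (der g) (mbr f h) + (-1) ^ (d * q)
         *: mbr g (mbr (der f) h + (-1) ^ (d * p) *: mbr f (der h))))
    = (mbr (der f) (mbr g h) - mbr (mbr (der f) g) h
         - (-1) ^ ((p + d) * q) *: mbr g (mbr (der f) h))
      + ((-1) ^ (d * p) *: (mbr f (mbr (der g) h) - mbr (mbr f (der g)) h
         - (-1) ^ (p * (q + d)) *: mbr (der g) (mbr f h))
      + (-1) ^ (d * (p + q)) *: (mbr f (mbr g (der h)) - mbr (mbr f g) (der h)
         - (-1) ^ (p * q) *: mbr g (mbr f (der h)))).
    rewrite [mbr (der g) h + _]addrC [mbr (der f) h + _]addrC.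
    rewrite [mbr (der f) g + _]addrC !mbrDr mbrDl.
    rewrite !mulrDl !mulrDr !sgnD [p * d]mulrC.
    apply/funext => t.
    have alg (a1 a2 a3 a4 a5 a6 a7 a8 a9 c x y : rat) : x * x = 1 ->
        a1 + x * (y * a3 + a2) - (x * a5 + a4 + x * y * a6)
          - c * (a7 + y * (x * a9 + a8))
        = a1 - a4 - c * y * a8
          + (x * (a2 - a5 - c * x * a7) + x * y * (a3 - a6 - c * a9)).
      move=> xx; have -> : x * (a2 - a5 - c * x * a7) = x * (a2 - a5) - c * a7.
        by rewrite -[c * a7]mul1r -xx; ring.
      by ring.
    by apply: alg; apply: sgn2.
  apply: (IdD); last apply: (IdD).
  - have -> : p + q + r + d = p + d + q + r by ring.
    by apply: LieIdealJacobi => //; apply: der_homog.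
  - have -> : p + q + r + d = p + (q + d) + r by ring.
    by apply: IdZ; apply: LieIdealJacobi => //; apply: der_homog.
  - rewrite -[p + q + r + d]addrA.
    by apply: IdZ; apply: LieIdealJacobi => //; apply: der_homog.
- move=> p q f g fp Ig IHg; rewrite (der_mbr _ fp).
  apply: IdD; last first.
    by apply: IdZ; rewrite -addrA; apply: LieIdealMull.
  by rewrite addrAC; apply: LieIdealMull => //; apply: der_homog.
- move=> p q f g If IHf gq; rewrite (der_mbr _ (lieIdeal_homog If)).
  apply: IdD; first by rewrite addrAC; apply: LieIdealMulr.
  apply: IdZ; rewrite -addrA; apply: LieIdealMulr => //; exact: der_homog.
Qed.

Definition hder p (f : hseries deg p) : hseries deg (p + d) :=
  HSeries (der_homog (hvalP f)).

Definition freeLie_der p (x : freeLie deg p) : freeLie deg (p + d) :=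
  cls (hder (repr x)).

Lemma freeLie_derE p (f : hseries deg p) : freeLie_der (cls f) = cls (hder f).
Proof.
apply/cls_eq/lieRelP => n; have /lieRelP/(_ n)[h Ih fh] := lieRel_repr f.
exists (der h); first exact: lieIdeal_der.
move=> t tn; have -> : der h t = der (hval (repr (cls f)) - hval f) t.
  by apply: derc_agree => s st; rewrite -fh//; apply: leq_trans tn.
have := der_linear (-1) (hval f) (hval (repr (cls f))).
by rewrite !scaleN1r ![- _ + _]addrC => ->.
Qed.

Fact freeLie_der_linear p : linear (@freeLie_der p).
Proof.
move=> a x y; rewrite -[x]cls_repr -[y]cls_repr -cls_linear !freeLie_derE.
rewrite -cls_linear; congr cls; apply: hval_inj; exact: der_linear.
Qed.
HB.instance Definition _ p :=
  GRing.isLinear.Build rat (freeLie deg p) (freeLie deg (p + d)) *:%R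
    (@freeLie_der p) (@freeLie_der_linear p).

Lemma freeLie_der_bracket p q r (e : p + q = r)
    (el : p + d + q = r + d) (er : p + (q + d) = r + d)
    (x : freeLie deg p) (y : freeLie deg q) :
  freeLie_der (bracket e x y) = bracket el (freeLie_der x) y
    + (-1) ^ (d * p) *: bracket er x (freeLie_der y).
Proof.
rewrite /freeLie /= -[x]cls_repr -[y]cls_repr freeLie_bracketE !freeLie_derE.
rewrite !freeLie_bracketE -cls_scale -clsD; congr cls; apply: hval_inj.
exact/der_mbr/hvalP.
Qed.

Lemma freeLie_der_gen a : freeLie_der (gen deg (deg a) a) =
  cls (HSeries (th_homog a)).
Proof.
rewrite /gen /= freeLie_derE; congr cls; apply: hval_inj.
have genE t : \sum_b gen_series deg (deg a) a (Leaf b) * th b t = th a t.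
  rewrite (bigD1 a)//= !eqxx mul1r big1 ?addr0// => b /negPf ba.
  by rewrite ba mul0r.
apply/funext => -[y|s u]; first exact: etrans (dercL _ _) (genE _).
apply: etrans (dercN _ _ _) _; rewrite genE !derc0 ?mulr0//.
by rewrite !addr0.
Qed.
End Derivation.

Lemma freeLie_derivation_lift (X : finType) (deg : X -> int) (d : int)
    (y : forall a, freeLie deg (deg a + d)) :
  exists h : forall p, {linear freeLie deg p -> freeLie deg (p + d)},
    (forall a, h _ (gen deg (deg a) a) = y a) /\
    (forall p q r (e : p + q = r)
        (el : p + d + q = r + d) (er : p + (q + d) = r + d)
        (x : freeLie deg p) (z : freeLie deg q),
      h r (bracket e x z) = bracket el (h p x) z
        + (-1) ^ (d * p) *: bracket er x (h q z)).
Proof.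
have th_homog a := hvalP (repr (y a)).
exists (fun p => @freeLie_der _ _ _ _ th_homog p : {linear _ -> _}).
split=> [a|]; last exact: freeLie_der_bracket.
rewrite [LHS]freeLie_der_gen -[RHS]cls_repr; congr cls; exact: hval_inj.
Qed.

(** * Unipotent automorphisms *)

Section LieHomOps.
Implicit Types (L M N : gradedLie).

Fact lieId_bracket L p q r (e : p + q = r) (x : L p) (y : L q) :
  (idfun : {linear L r -> L r}) (bracket e x y)
  = bracket e ((idfun : {linear L p -> L p}) x) ((idfun : {linear L q -> L q}) y).
Proof. by []. Qed.

Definition lieId L : lieHom L L :=
  @LieHom L L (fun p => idfun : {linear L p -> L p}) (@lieId_bracket L).

Definition lieComp L M N (g : lieHom M N) (f : lieHom L M) : lieHom L N.
refine (@LieHom L N (fun p => g p \o f p : {linear L p -> N p}) _).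
by move=> p q r e x y; rewrite /= !lhom_bracket.
Defined.

Lemma lieHom_inverse L M (f : lieHom L M) :
  (forall p (y : M p), exists x, f p x = y) ->
  (forall p (x : L p), f p x = 0 -> x = 0) ->
  {g : lieHom M L | (forall p x, g p (f p x) = x) /\ (forall p y, f p (g p y) = y)}.
Proof.
move=> f_surj f_ker.
have f_inj p (x y : L p) : f p x = f p y -> x = y.
  move=> fxy; apply/eqP; rewrite -subr_eq0; apply/eqP/f_ker.
  by rewrite linearB fxy subrr.
pose g p (y : M p) := sval (cid (f_surj p y)).
have fg p y : f p (g p y) = y by exact: svalP (cid (f_surj p y)).
have g_lin p : linear (g p).
  by move=> a x y; apply: f_inj; rewrite linearP !fg.
pose gL p : {linear M p -> L p} :=
  HB.pack (g p) (GRing.isLinear.Build rat (M p) (L p) *:%R (g p) (g_lin p)).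
have g_br p q r (e : p + q = r) x y :
    gL r (bracket e x y) = bracket e (gL p x) (gL q y).
  by apply: f_inj; rewrite lhom_bracket !fg.
by exists (LieHom g_br); split=> p x; rewrite /= ?fg//; apply: f_inj; rewrite fg.
Qed.
End LieHomOps.

Section Conjugate.
Variables (L M : gradedLie) (D : differential M) (f : lieHom L M) (g : lieHom M L).
Hypotheses (gf : forall p x, g p (f p x) = x) (fg : forall p y, f p (g p y) = y).

Definition conj_differential : differential L.
refine (@Differential L
  (fun p => g (p - 1) \o (D p \o f p) : {linear L p -> L (p - 1)}) _ _).
- move=> p q r e el er x y /=; rewrite lhom_bracket (dfun_derivation _ _ el er).
  by rewrite linearD linearZ /= !lhom_bracket !gf.
- by move=> p x /=; rewrite fg dfun_sq linear0.
Defined.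

Lemma conj_differentialE p (x : L p) : conj_differential p x = g _ (D p (f p x)).
Proof. by []. Qed.
End Conjugate.

Section Unipotent.
Variables (X : finType) (deg : X -> int).
Local Notation L := (freeLie deg).
Implicit Types f : lieHom L L.

(** Only the linear part is constrained: such a morphism is the identity on each
    quotient of consecutive terms of the filtration. *)
Definition unipotent f :=
  forall a, f _ (gen deg (deg a) a) - gen deg (deg a) a \in fil 2.

Section Theory.
Variable f : lieHom L L.
Hypothesis f_unip : unipotent f.

Lemma unipotent_fil k p (x : L p) : x \in fil k.+1 -> f p x - x \in fil k.+2.
Proof. by move=> /(lieHom_close (g := lieId L) (m := 1) f_unip). Qed.

Lemma unipotent_reflect k p (x : L p) : f p x \in fil k -> x \in fil k.
Proof.
elim: k => [_|k IHk fx]; first exact: filW (fil1 _).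
case: k IHk fx => [|k] IHk fx; first exact: fil1.
have /unipotent_fil xk := IHk (filW (leqnSn _) fx).
by rewrite -[x](subKr (f p x)) rpredB.
Qed.

(** Surjectivity is Newton iteration: the error y - f x of an approximate
    preimage x is added to x, which improves it by one step. *)
Lemma unipotent_inverse :
  {g : lieHom L L | (forall p x, g p (f p x) = x) /\ (forall p y, f p (g p y) = y)}.
Proof.
apply: lieHom_inverse => p; last first.
  move=> x fx0; apply: fil_separated => k.
  by apply: unipotent_reflect; rewrite fx0 rpred0.
move=> y; pose u := fix u k := if k is k'.+1 then u k' + (y - f p (u k')) else y.
have uP k : y - f p (u k) \in fil k.+1.
  elim: k => [|k IHk] /=; first exact: fil1.
  set w := y - f p (u k) in IHk *.
  have -> : y - f p (u k + w) = - (f p w - w).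
    by rewrite linearD opprB opprD addrA.
  by rewrite rpredN; apply: unipotent_fil.
have [x xP] : exists x, forall k, x - u k \in fil k.
  by apply: fil_complete => k; rewrite /= addrAC subrr add0r; apply: filW (uP k).
exists x; apply/eqP; rewrite -subr_eq0; apply/eqP/fil_separated => k.
rewrite -(subrK (f p (u k)) (f p x)) -addrA -linearB /=.
apply: rpredD; first exact/lieHom_fil/xP.
by rewrite -opprB rpredN; apply: filW (uP k).
Qed.
End Theory.
End Unipotent.

(** * Acyclicity from a contracting derivation *)

Section DegreeCast.
Variable L : gradedLie.
Implicit Types (p q r : int).

Definition castL p q (e : p = q) (x : L p) : L q := ecast i (L i) e x.

Lemma castLD p q (e : p = q) x y : castL e (x + y) = castL e x + castL e y.
Proof. by case: q / e. Qed.

Lemma castLB p q (e : p = q) x y : castL e (x - y) = castL e x - castL e y.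
Proof. by case: q / e. Qed.

Lemma castLZ p q (e : p = q) a x : castL e (a *: x) = a *: castL e x.
Proof. by case: q / e. Qed.

Lemma castL_id p (e : p = p) x : castL e x = x.
Proof. by rewrite (eq_irrelevance e erefl). Qed.

Lemma castL_irr p q (e e' : p = q) x : castL e x = castL e' x.
Proof. by rewrite (eq_irrelevance e e'). Qed.

Lemma bracket_irr p q r (e e' : p + q = r) (x : L p) (y : L q) :
  bracket e x y = bracket e' x y.
Proof. by rewrite (eq_irrelevance e e'). Qed.

Lemma castL_bracket p q r r' (e : r = r') (e1 : p + q = r) (e2 : p + q = r')
    (x : L p) (y : L q) : castL e (bracket e1 x y) = bracket e2 x y.
Proof. by case: r' / e e2 => e2; apply: bracket_irr. Qed.

Lemma bracket_castl p p' q r (a : p = p') (e : p' + q = r) (e' : p + q = r)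
    (x : L p) (y : L q) : bracket e (castL a x) y = bracket e' x y.
Proof. by case: p' / a e => e; apply: bracket_irr. Qed.

Lemma bracket_castr p q q' r (a : q = q') (e : p + q' = r) (e' : p + q = r)
    (x : L p) (y : L q) : bracket e x (castL a y) = bracket e' x y.
Proof. by case: q' / a e => e; apply: bracket_irr. Qed.

Lemma castL_differential (D : differential L) p q (e : p = q) (e' : p - 1 = q - 1) x :
  D q (castL e x) = castL e' (D p x).
Proof. by case: q / e e' => e'; rewrite !castL_id. Qed.
End DegreeCast.

Lemma castL_fil (X : finType) (deg : X -> int) k p q (e : p = q)
    (x : freeLie deg p) : (castL e x \in fil k) = (x \in fil k).
Proof. by case: q / e. Qed.

Section Contraction.
Variables (X : finType) (deg : X -> int).
Local Notation L := (freeLie deg).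
Variables (D : differential L) (h : forall p, {linear L p -> L (p + 1)}).
Hypothesis h_der : forall p q r (e : p + q = r)
  (el : p + 1 + q = r + 1) (er : p + (q + 1) = r + 1) (x : L p) (y : L q),
  h r (bracket e x y) = bracket el (h p x) y
    + (-1) ^ (1 * p) *: bracket er x (h q y).

Fact degDh (p : int) : p + 1 - 1 = p.
Proof. exact: addrK. Qed.

Fact deghD (p : int) : p - 1 + 1 = p.
Proof. exact: subrK. Qed.

(** The operator D h + h D. *)
Definition laplacian p (x : L p) : L p :=
  castL (degDh p) (D (p + 1) (h p x)) + castL (deghD p) (h (p - 1) (D p x)).

Lemma laplacian_lin p a (x y : L p) :
  laplacian (a *: x + y) = a *: laplacian x + laplacian y.
Proof.
have DZ t (u v : L t) : D t (a *: u + v) = a *: D t u + D t v by rewrite linearP.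
have hZ t (u v : L t) : h t (a *: u + v) = a *: h t u + h t v by rewrite linearP.
rewrite /laplacian DZ hZ DZ hZ.
by rewrite !castLD !castLZ scalerDr addrACA.
Qed.

Lemma homotopy_fil k p (x : L p) : x \in fil k -> h p x \in fil k.
Proof.
case: k => [_|k]; first exact: filW (fil1 _).
apply: (@fil_growth _ _ _ _ (fun p => p + 1) (fun p => h p) 0) => {k p x}.
- by move=> p a x y; rewrite linearP.
- by move=> a; apply: fil1.
move=> a p r e z j i zj fz.
have el : deg a + 1 + p = r + 1 by rewrite -e addrAC.
have er : deg a + (p + 1) = r + 1 by rewrite -e addrA.
rewrite (h_der e el er); apply: rpredD.
  by apply: filW (fil_bracket el (fil1 _) zj); lia.
by apply/rpredZ/(filW _ (fil_bracket er (fil1 _) fz)); lia.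
Qed.

Lemma laplacian_fil k p (x : L p) : x \in fil k -> laplacian x \in fil k.
Proof.
move=> xk; apply: rpredD; rewrite castL_fil.
  exact/differential_fil/homotopy_fil.
exact/homotopy_fil/differential_fil.
Qed.

Lemma laplacian_differential p (x : L p) :
  laplacian (D p x) = D p (laplacian x).
Proof.
rewrite /laplacian dfun_sq linear0 linearD /=.
have eDh : p + 1 - 1 - 1 = p - 1 by rewrite degDh.
have ehD : p - 1 + 1 - 1 = p - 1 by rewrite deghD.
rewrite (castL_differential D _ eDh) (castL_differential D _ ehD) dfun_sq.
have c0 p1 p2 (e : p1 = p2) : castL e (0 : L p1) = 0 by case: p2 / e.
rewrite !c0 add0r addr0; exact: (@castL_irr L _ _ (degDh (p-1)) ehD).
Qed.

(** The mixed terms h x, D y and D x, h y occur twice, with opposite signs. *)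
Lemma laplacian_bracket p q r (e : p + q = r) (x : L p) (y : L q) :
  laplacian (bracket e x y) = bracket e (laplacian x) y + bracket e x (laplacian y).
Proof.
rewrite /laplacian.
have e1 : p + 1 + q = r + 1 by lia.
have e2 : p + (q + 1) = r + 1 by lia.
have e3 : p - 1 + q = r - 1 by lia.
have e4 : p + (q - 1) = r - 1 by lia.
have f1 : p + 1 - 1 + q = r + 1 - 1 by lia.
have f2 : p + 1 + (q - 1) = r + 1 - 1 by lia.
have f3 : p - 1 + (q + 1) = r + 1 - 1 by lia.
have f4 : p + (q + 1 - 1) = r + 1 - 1 by lia.
have g1 : p - 1 + 1 + q = r - 1 + 1 by lia.
have g2 : p - 1 + (q + 1) = r - 1 + 1 by lia.
have g3 : p + 1 + (q - 1) = r - 1 + 1 by lia.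
have g4 : p + (q - 1 + 1) = r - 1 + 1 by lia.
have k1 : p + 1 - 1 + q = r by lia.
have k2 : p + 1 + (q - 1) = r by lia.
have k3 : p - 1 + (q + 1) = r by lia.
have k4 : p + (q + 1 - 1) = r by lia.
have k5 : p - 1 + 1 + q = r by lia.
have k6 : p + (q - 1 + 1) = r by lia.
rewrite (h_der _ e1 e2) (dfun_derivation D _ e3 e4).
have DZ t a (u v : L t) : D t (u + a *: v) = D t u + a *: D t v.
  by rewrite linearD linearZ.
have hZ t a (u v : L t) : h t (u + a *: v) = h t u + a *: h t v.
  by rewrite linearD linearZ.
rewrite DZ hZ (dfun_derivation D _ f1 f2) (dfun_derivation D _ f3 f4).
rewrite (h_der _ g1 g2) (h_der _ g3 g4).
rewrite !(castLD, castLZ).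
rewrite (castL_bracket _ _ k1) !(castL_bracket _ _ k2) !(castL_bracket _ _ k3).
rewrite (castL_bracket _ _ k4) (castL_bracket _ _ k5) (castL_bracket _ _ k6).
rewrite bracketDl bracketDr (bracket_castl _ _ k1) (bracket_castl _ _ k5).
rewrite (bracket_castr _ _ k4) (bracket_castr _ _ k6).
have s2 : (-1) ^ p * (-1) ^ p = 1 :> rat.
  by rewrite -expfzMl mulrNN mulr1 exp1rz.
have sS : (-1) ^ (p + 1) = - (-1) ^ p :> rat by rewrite expfzDr// mulrN1.
have sP : (-1) ^ (p - 1) = - (-1) ^ p :> rat by rewrite expfzDr// mulrN1.
rewrite !mul1r sS sP !scalerDr !scalerA s2 !scale1r !scaleNr.
have shuffle (a b c d u v : L r) :
    a - b + (c + d) + (u - c + (b + v)) = a + u + (d + v).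
  rewrite addrACA [a - b + _]addrACA -opprD [c + d + _]addrACA [c + b]addrC.
  by rewrite -addrA addKr.
exact: shuffle.
Qed.

(** An eigenvector of the operator induced on the k-th graded piece.  The last
    clause records that the eigenvalue 0 comes from brackets whose k factors all
    have degree -1. *)
Definition eigenvec k p (m : nat) (x : L p) :=
  [/\ x \in fil k, laplacian x - m%:R *: x \in fil k.+1
    & m = 0%N -> p = - k%:Z].

(** Sums of eigenvectors modulo longer brackets; the number of summands is an
    index because [graded_acyclic] is proved by induction on it. *)
Inductive eigensum k p : nat -> L p -> Prop :=
| EigenNil x : x \in fil k.+1 -> eigensum k 0 x
| EigenCons n m x y : eigenvec k m x -> eigensum k n y -> eigensum k n.+1 (x + y).

Lemma laplacianD p (x y : L p) : laplacian (x + y) = laplacian x + laplacian y.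
Proof. by have := laplacian_lin 1 x y; rewrite !scale1r. Qed.

Lemma laplacianZ p a (x : L p) : laplacian (a *: x) = a *: laplacian x.
Proof.
have l0 : laplacian (0 : L p) = 0.
  by apply: (addrI (laplacian 0)); rewrite -laplacianD !addr0.
by have := laplacian_lin a x 0; rewrite l0 !addr0.
Qed.

Lemma laplacianB p (x y : L p) : laplacian (x - y) = laplacian x - laplacian y.
Proof. by rewrite -scaleN1r laplacianD laplacianZ scaleN1r. Qed.

Lemma eigensum_rem k p n (x y : L p) :
  eigensum k n x -> y \in fil k.+1 -> eigensum k n (x + y).
Proof.
elim=> [z zk yk|m l z w zl _ IHw yk]; first exact/EigenNil/rpredD.
by rewrite -addrA; apply: EigenCons zl (IHw yk).
Qed.

Lemma eigensumD k p n n' (x y : L p) :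
  eigensum k n x -> eigensum k n' y -> eigensum k (n + n') (x + y).
Proof.
elim=> [z zk yn|m l z w zl _ IHw yn]; first by rewrite addrC; apply: eigensum_rem.
by rewrite -addrA addSn; apply: EigenCons zl (IHw yn).
Qed.

(** Any linear combination of x and its image under the operator is again an
    eigenvector, possibly zero, with the same eigenvalue; this keeps the number
    of summands in [eigensum_comb]. *)
Lemma eigenvec_comb k p m a b (x : L p) :
  eigenvec k m x -> eigenvec k m (a *: x + b *: laplacian x).
Proof.
move=> [xk xm mp]; split=> //.
  by apply: rpredD; apply: rpredZ => //; apply: laplacian_fil.
rewrite laplacianD !laplacianZ [m%:R *: _]scalerDr !scalerA ![m%:R * _]mulrC -!scalerA.
rewrite opprD addrACA -!scalerBr -laplacianZ -laplacianB.
by apply: rpredD; apply: rpredZ => //; apply: laplacian_fil.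
Qed.

Lemma eigensum_comb k p n a b (x : L p) :
  eigensum k n x -> eigensum k n (a *: x + b *: laplacian x).
Proof.
elim=> [z zk|m l z w zl _ IHw].
  by apply: EigenNil; apply: rpredD; apply: rpredZ => //; apply: laplacian_fil.
rewrite laplacianD (scalerDr a) (scalerDr b (laplacian z)) addrACA.
exact: EigenCons (eigenvec_comb a b zl) IHw.
Qed.

Lemma eigensum_fil k p n (x : L p) : eigensum k n x -> x \in fil k.
Proof.
elim=> [z|m l z w [zk _ _] _ IHw]; first by apply: filW.
exact: rpredD.
Qed.

(** Eigenvalues add up because the operator is a derivation. *)
Lemma eigenvec_bracket j k p q r (e : p + q = r) m l (x : L p) (y : L q) :
  eigenvec j m x -> eigenvec k l y -> eigenvec (j + k) (m + l) (bracket e x y).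
Proof.
move=> [xj xm mp] [yk yl lq]; split.
- exact: fil_bracket.
- rewrite laplacian_bracket natrD scalerDl opprD addrACA.
  rewrite -(bracketZl e) -(bracketZr e) -(@bracketBl L) -(@bracketBr L).
  apply: rpredD; first by rewrite -addSn; apply: fil_bracket.
  by rewrite -addnS; apply: fil_bracket.
- by move=> ml; rewrite -e mp ?lq ?PoszD ?opprD//; lia.
Qed.

Lemma eigensum_bracket j k p q r (e : p + q = r) n n' (x : L p) (y : L q) :
  eigensum j n x -> eigensum k n' y ->
  exists N, eigensum (j + k) N (bracket e x y).
Proof.
move=> xn yn'; have yk := eigensum_fil yn'.
elim: xn => [z zj|m l z w zl _ [N wN]].
  by exists 0%N; apply: EigenNil; rewrite -addSn; apply: fil_bracket.
suff [N' zN'] : exists N, eigensum (j + k) N (bracket e z y).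
  by exists (N' + N)%N; rewrite (@bracketDl L); apply: eigensumD.
elim: yn' {N w wN yk} => [w wk|m' l' u w ul' _ [N wN]].
  exists 0%N; apply: EigenNil; rewrite -addnS.
  by case: zl => zj _ _; apply: fil_bracket.
by exists N.+1; rewrite (@bracketDr L); exact: EigenCons (eigenvec_bracket e zl ul') wN.
Qed.

Hypothesis gen_eigensum : forall a,
  exists n, eigensum 1 n (gen deg (deg a) a).

Lemma fil_eigensum k p (x : L p) : x \in fil k.+1 -> exists n, eigensum k.+1 n x.
Proof.
elim: k p x => [|k IHk] p x.
  move=> _; have [c cx] := fil_gens x; rewrite -(subrK (\sum_a c a *: gen deg p a) x).
  suff [n sn] : exists n, eigensum 1 n (\sum_a c a *: gen deg p a).
    by exists n; rewrite addrC; apply: eigensum_rem.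
  apply: (big_ind (fun y => exists n, eigensum 1 n y)) => [|y z [n yn] [n' zn']|a _].
  - by exists 0%N; apply/EigenNil/rpred0.
  - by exists (n + n')%N; apply: eigensumD.
  have [<-|ap] := eqVneq (deg a) p.
    have [n an] := gen_eigensum a; exists n.
    by have := eigensum_comb (c a) 0 an; rewrite scale0r addr0.
  by rewrite gen_eq0// scaler0; exists 0%N; apply/EigenNil/rpred0.
apply: (fil_ind (P := fun y => exists n, eigensum k.+2 n y)) => // [|y z [n yn] [n' zn']|a q e z zk].
- by exists 0%N; apply/EigenNil/rpred0.
- by exists (n + n')%N; apply: eigensumD.
have [n an] := gen_eigensum a; have [n' zn'] := IHk _ _ zk.
by have [N] := eigensum_bracket e an zn'; rewrite add1n; exists N.
Qed.

Lemma eigensum_inv k p n (x : L p) : eigensum k n x ->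
  if n is n'.+1 then
    exists m x' y, [/\ eigenvec k m x', eigensum k n' y & x = x' + y] : Prop
  else (x \in fil k.+1 : Prop).
Proof. by case=> // n' m x' y xm yn; exists m, x', y. Qed.

(** If m is the eigenvalue of the first summand of the cycle z, then z - m^-1 E z
    is a cycle with one summand fewer, and E z is the boundary of h z modulo
    longer brackets; here m is nonzero by the assumption on the degree. *)
Lemma graded_acyclic k p (z : L (p - 1)) : (0 < k)%N -> p - 1 <> - k%:Z ->
  z \in fil k -> D _ z \in fil k.+1 ->
  exists2 y : L p, y \in fil k & z - D p y \in fil k.+1.
Proof.
case: k => // k _ pk zk; have [n zn] := fil_eigensum zk.
elim: n z zk zn => [|n IHn] z zk zn Dz.
  exists 0; first exact: rpred0.
  by rewrite linear0 subr0; apply: (eigensum_inv zn).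
have [m [x [y [[xk xm mp] yn zE]]]] := eigensum_inv zn.
have m0 : m%:R != 0 :> rat by rewrite pnatr_eq0; apply/eqP => /mp.
pose c : rat := - m%:R^-1; pose z' := 1 *: z + c *: laplacian z.
have z'k : z' \in fil k.+1.
  by apply: rpredD; apply: rpredZ => //; apply: laplacian_fil.
have z'n : eigensum k.+1 n z'.
  have -> : z' = (1 *: y + c *: laplacian y) + (x + c *: laplacian x).
    rewrite /z' zE laplacianD (scalerDr 1) (scalerDr c) !scale1r.
    by rewrite addrACA addrC.
  apply: eigensum_rem; first exact: eigensum_comb.
  have -> : x + c *: laplacian x = c *: (laplacian x - m%:R *: x).
    rewrite (scalerBr c) scalerA /c mulNr mulVf// scaleN1r opprK; exact: addrC.
  exact: rpredZ.
have Dz' : D _ z' \in fil k.+2.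
  rewrite linearD !linearZ /= -laplacian_differential.
  by apply: rpredD; apply: rpredZ => //; apply: laplacian_fil.
have [y' y'k z'y'] := IHn _ z'k z'n Dz'.
have e : p - 1 + 1 = p by lia.
have e1 : p - 1 + 1 - 1 = p - 1 by lia.
exists (y' - c *: castL e (h _ z)).
  by apply: rpredB => //; apply: rpredZ; rewrite castL_fil homotopy_fil.
rewrite linearB linearZ /= (castL_differential D _ e1).
have -> : z - (D p y' - c *: castL e1 (D _ (h _ z)))
    = (z' - D p y') - c *: castL (deghD (p - 1)) (h _ (D _ z)).
  rewrite /z' scale1r /laplacian scalerDr (@castL_irr L _ _ (degDh (p - 1)) e1).
  set u := c *: castL e1 _; set v := c *: castL _ _.
  have shuffle (a b d f : L (p - 1)) : a - (b - d) = a + (d + f) - b - f.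
    by rewrite opprB addrA (addrAC _ (- b)) [a + (d + f)]addrA addrK.
  exact: shuffle.
by apply: rpredB => //; apply: rpredZ; rewrite castL_fil homotopy_fil.
Qed.
End Contraction.

(** * Morphisms induced by maps of vertices *)

Section StandardMaps.
Implicit Types (n m : nat) (p : int).

Lemma sgen_val n p (K : simplex n) : sgen p (val K) = gen (@simplex_deg n) p K.
Proof. by rewrite /sgen valK. Qed.

Lemma sgen0 n p : sgen p (set0 : {set 'I_n.+1}) = 0.
Proof. by rewrite /sgen insubF ?eqxx. Qed.

Lemma sgen_eq0 n p (J : {set 'I_n.+1}) : sdeg J != p -> sgen p J = 0.
Proof. by rewrite /sgen; case: insubP => // K _ <- Jp; apply: gen_eq0. Qed.

Lemma simplexLie_ext n m (f g : lieHom (simplexLie n) (simplexLie m)) :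
  (forall J, f _ (sgen (sdeg J) J) = g _ (sgen (sdeg J) J)) ->
  forall p x, f p x = g p x.
Proof.
move=> fg; apply: lieHom_ext => K.
by have := fg (val K); rewrite -[sdeg (val K)]/(simplex_deg K) sgen_val.
Qed.

(** If f is not injective on J, then f J has too few elements, and the generator of
    the degree of J attached to it is 0 by convention, as it should be. *)
Definition vertexMap n m (f : 'I_n.+1 -> 'I_m.+1) : lieHom (simplexLie n) (simplexLie m) :=
  sval (freeLie_lift (fun K : simplex n =>
    sgen (simplex_deg K) (f @: val K) : freeLie (@simplex_deg m) _)).

Lemma vertexMap_sgen n m (f : 'I_n.+1 -> 'I_m.+1) p (J : {set 'I_n.+1}) :
  sdeg J = p -> vertexMap f p (sgen p J) = sgen p (f @: J).
Proof.
move=> <-; have [->|J0] := eqVneq J set0.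
  by rewrite imset0 !sgen0 linear0.
have := svalP (freeLie_lift (fun K : simplex n =>
    sgen (simplex_deg K) (f @: val K) : freeLie (@simplex_deg m) _)) (Sub J J0).
by rewrite -sgen_val SubK.
Qed.

Lemma eq_vertexMap n m (f g : 'I_n.+1 -> 'I_m.+1) p x : f =1 g -> vertexMap f p x = vertexMap g p x.
Proof. by move=> /funext ->. Qed.

Lemma vertexMap_comp n m l (g : 'I_m.+1 -> 'I_l.+1) (f : 'I_n.+1 -> 'I_m.+1) p x :
  vertexMap g p (vertexMap f p x) = vertexMap (g \o f) p x.
Proof.
apply: (simplexLie_ext (f := lieComp (vertexMap g) (vertexMap f)) (g := vertexMap (g \o f))) => J.
rewrite /= (vertexMap_sgen f erefl) (vertexMap_sgen (g \o f) erefl) (imset_comp g f).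
have [fJ|fJ] := eqVneq (sdeg (f @: J)) (sdeg J); first exact: vertexMap_sgen.
rewrite (sgen_eq0 fJ) linear0 sgen_eq0//.
have le1 : (#|f @: J| <= #|J|)%N := leq_imset_card f J.
have le2 : (#|g @: (f @: J)| <= #|f @: J|)%N := leq_imset_card g _.
apply/eqP => /addIr[gfJ]; case/eqP: fJ; rewrite /sdeg; congr (_%:Z - _).
by apply/eqP; rewrite eqn_leq le1 -gfJ.
Qed.

Lemma vertexMap_id n (f : 'I_n.+1 -> 'I_n.+1) p x : f =1 id -> vertexMap f p x = x.
Proof.
move=> fid; apply: (simplexLie_ext (f := vertexMap f) (g := lieId (simplexLie n))) => J.
by rewrite vertexMap_sgen//= (eq_imset _ fid) imset_id.
Qed.

Lemma coface_vertexMap n (i : 'I_n.+2) p x : coface i p x = vertexMap (lift i) p x.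
Proof.
apply: (simplexLie_ext (f := coface i) (g := vertexMap (lift i))) => J.
by rewrite coface_sgen vertexMap_sgen.
Qed.

(** The degeneracy which repeats the vertex i. *)
Definition codegen n (i : 'I_n.+1) (j : 'I_n.+2) : 'I_n.+1 := inord (unbump i j).

Lemma val_codegen n (i : 'I_n.+1) (j : 'I_n.+2) : codegen i j = unbump i j :> nat.
Proof.
by rewrite inordK// /unbump; have := ltn_ord i; have := ltn_ord j; case: ltnP; lia.
Qed.

Lemma vertexMap_cosimplicial :
  cosimplicial_identities coface (fun n i => vertexMap (@codegen n i)).
Proof.
split=> n; [move=> i j1 i' j ei ej ij | move=> i j1 i' j ei ej ij
  | move=> i j i' j1 ei ej ij | move=> i j ij | move=> i j i1 j' ei ej ij] => p x;
  rewrite ?coface_vertexMap ?vertexMap_comp.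
- apply: eq_vertexMap => a; apply: ord_inj; rewrite /= /bump ei ej.
  by case: (leqP i a); case: (leqP j1 a); lia.
- apply: eq_vertexMap => a; apply: ord_inj; rewrite /= !val_codegen /unbump ei ej.
  by case: (ltnP i a); case: (ltnP j a); lia.
- apply: eq_vertexMap => a; apply: ord_inj; rewrite /= !val_codegen /= /unbump /bump ei ej.
  by case: (leqP i a); case: (ltnP j1 a); lia.
- apply: vertexMap_id => a; apply: ord_inj; rewrite /= val_codegen /= /unbump /bump.
  by case: (leqP i a); case: ij; lia.
- apply: eq_vertexMap => a; apply: ord_inj; rewrite /= !val_codegen /= /unbump /bump ei ej.
  by case: (leqP i1 a); case: (ltnP j a); lia.
Qed.
End StandardMaps.

Lemma sdegD1 n (J : {set 'I_n.+1}) x : x \in J -> sdeg (J :\ x) = sdeg J - 1.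
Proof. by move=> xJ; rewrite /sdeg (cardsD1 x J) xJ; lia. Qed.

Lemma codegen_lift n (i : 'I_n.+1) (j : 'I_n.+2) :
  j = i :> nat \/ j = i.+1 :> nat -> forall a : 'I_n.+1, codegen i (lift j a) = a.
Proof.
move=> ij a; apply: ord_inj; rewrite val_codegen /= /unbump /bump.
by case: (leqP j a); case: ij; lia.
Qed.

(** Only the faces opposite to i and i + 1 survive; they have the same image and
    opposite signs. *)
Lemma vertexMap_codegen_slin n (i : 'I_n.+1) :
  vertexMap (codegen i) _ (slin [set: 'I_n.+2]) = 0.
Proof.
set T := [set: 'I_n.+2]; pose i1 : 'I_n.+2 := lift ord0 i.
pose i0 : 'I_n.+2 := widen_ord (leqnSn _) i.
have i10 : i1 != i0 by rewrite -val_eqE /= /bump /=; lia.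
have full (j : 'I_n.+2) : j = i :> nat \/ j = i.+1 :> nat -> codegen i @: (T :\ j) = setT.
  move=> ij; apply/eqP; rewrite eqEsubset subsetT; apply/subsetP => a _.
  rewrite -(codegen_lift ij a); apply: imset_f.
  by rewrite !inE eq_sym neq_lift.
rewrite /slin linear_sum (bigD1 i0) ?inE//= (bigD1 i1) ?inE//= big1 ?addr0.
  rewrite !linearZ /= !vertexMap_sgen ?sdegD1 ?inE// !full; first last.
  - by left.
  - by right; rewrite /= /bump.
  (* The rank of i + 1 exceeds that of i by one, whence opposite signs. *)
  have -> : [set y in T | (y < i1)%N] = i0 |: [set y in T | (y < i0)%N].
    by apply/setP => y; rewrite !inE -val_eqE /= /bump /= add1n ltnS leq_eqVlt.
  by rewrite cardsU1 !inE ltnn add1n exprS mulN1r scaleNr addrN.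
move=> x /andP[/andP[_ xi0] xi1]; rewrite linearZ /= vertexMap_sgen ?sdegD1 ?inE//.
(* A nonzero term would make the degeneracy injective off x, but i and i + 1
   are both different from x. *)
rewrite sgen_eq0 ?scaler0//; apply: contraNneq i10.
rewrite -(sdegD1 (in_setT x)) => /addIr[cardE].
have /imset_injP inj : #|codegen i @: (T :\ x)| == #|T :\ x|.
  by rewrite cardE.
apply/eqP/inj; rewrite ?inE ?andbT 1?eq_sym//.
by apply: ord_inj; rewrite !val_codegen /= /unbump /bump; case: ltnP; lia.
Qed.

(** * The cone contraction of a simplex *)

Section SimplexContraction.
Variable n : nat.
Local Notation L := (simplexLie n).
Local Notation pt := ([set ord0] : {set 'I_n.+1}).
Implicit Types (p q : int) (J : {set 'I_n.+1}).

(** The alternating sum of faces with a free degree q, to avoid casts. *)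
Definition slinq q J : L q :=
  \sum_(x in J) (-1 : rat) ^+ #|[set y in J | (y < x)%N]| *: sgen q (J :\ x).

Lemma slin_slinq q J (e : sdeg J - 1 = q) : slinq q J = castL e (slin J).
Proof. by case: q / e; rewrite castL_id. Qed.

Lemma castL_sgen p q (e : p = q) J : castL e (sgen p J : L p) = sgen q J.
Proof. by case: q / e. Qed.

Lemma castL_slinq p q (e : p = q) J : castL e (slinq p J) = slinq q J.
Proof. by case: q / e. Qed.

(** The derivation extending a_J |-> a_(0 J).  When 0 is already in J the value is 0,
    again by convention on degrees.  The second term of the formula only matters
    for J empty: there a_J = 0, but the first term is a_0. *)
Lemma cone_exists : exists h : forall p, {linear L p -> L (p + 1)},
  (forall J p, sdeg J = p -> h p (sgen p J) = sgen (p + 1) (ord0 |: J) - sgen (p + 1) pt) /\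
  (forall p q r (e : p + q = r) (el : p + 1 + q = r + 1) (er : p + (q + 1) = r + 1)
     (x : L p) (y : L q),
   h r (bracket e x y) = bracket el (h p x) y
     + (-1) ^ (1 * p) *: bracket er x (h q y)).
Proof.
have [h [hgen hbr]] := freeLie_derivation_lift (d := 1) (fun K : simplex n =>
  sgen (simplex_deg K + 1) (ord0 |: val K) : freeLie (@simplex_deg n) _).
exists h; split=> // J p <-; have [->|J0] := eqVneq J set0.
  by rewrite sgen0 linear0 setU0 subrr.
have := hgen (Sub J J0); rewrite -sgen_val SubK => ->.
rewrite (_ : sgen _ pt = 0) ?subr0//; apply: sgen_eq0.
rewrite /sdeg cards1; move: J0; rewrite -card_gt0 => J0.
by apply/eqP; lia.
Qed.

Lemma sign_first J x : (forall y, y \in J -> (x <= y)%N) ->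
  #|[set y in J | (y < x)%N]| = 0%N.
Proof.
move=> xJ; apply/eqP; rewrite cards_eq0; apply/eqP/setP => y; rewrite !inE.
by apply/negP => /andP[/xJ]; rewrite leqNgt => /negP.
Qed.

Lemma alternating_pt p J : sdeg J = p -> J != set0 ->
  \sum_(x in J) (-1 : rat) ^+ #|[set y in J | (y < x)%N]| *: (sgen p pt : L p)
  = sgen p pt.
Proof.
move=> Jp J0; have [pE|pN] := eqVneq (sdeg pt) p; last first.
  by rewrite sgen_eq0// big1 // => x _; rewrite scaler0.
have /cards1P[x ->] : #|J| == 1%N.
  by move: Jp; rewrite -pE => /addIr[->]; rewrite cards1.
by rewrite big_set1 sign_first ?scale1r// => y; rewrite inE => /eqP->.
Qed.

Section Homotopy.
Variable h : forall p, {linear L p -> L (p + 1)}.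
Hypothesis h_sgen : forall J p, sdeg J = p ->
  h p (sgen p J) = sgen (p + 1) (ord0 |: J) - sgen (p + 1) pt.

Lemma cone_slinq p J : sdeg J = p -> J != set0 ->
  castL (deghD p) (h _ (slinq (p - 1) J)) =
  \sum_(x in J) (-1) ^+ #|[set y in J | (y < x)%N]| *: sgen p (ord0 |: (J :\ x))
  - sgen p pt.
Proof.
move=> Jp J0; rewrite -[in RHS](alternating_pt Jp J0) -sumrB.
have castL_sum (I : finType) (P : pred I) q q' (e : q = q') (F : I -> L q) :
    castL e (\sum_(i | P i) F i) = \sum_(i | P i) castL e (F i).
  by case: q' / e.
rewrite linear_sum castL_sum; apply: eq_bigr => x xJ.
rewrite linearZ /= h_sgen ?sdegD1 ?Jp// castLZ castLB !castL_sgen.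
by rewrite scalerBr.
Qed.

(** The classical cone formula d h + h d = 1 - p, where p maps every vertex to a_0
    and the other generators to 0; indeed the last term vanishes unless J has
    the degree of a vertex.  If 0 is in J then d h is absent, and the face
    opposite to 0 is the only one whose cone is nonzero; otherwise this is the
    face of 0 J opposite to 0, and the others cancel with those of h d. *)
Lemma cone_homotopy p J : sdeg J = p -> J != set0 ->
  (if ord0 \in J then 0 else slinq p (ord0 |: J))
  + castL (deghD p) (h _ (slinq (p - 1) J)) = sgen p J - sgen p pt.
Proof.
move=> Jp J0; rewrite (cone_slinq Jp J0) addrA; congr (_ - _).
have [zJ|zJ] := boolP (ord0 \in J).
  rewrite add0r (bigD1 ord0)//= sign_first// scale1r setD1K// big1 ?addr0//.
  move=> x /andP[xJ x0]; rewrite sgen_eq0 ?scaler0//.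
  rewrite (setUidPr _) ?sdegD1 ?Jp//; last by rewrite sub1set !inE eq_sym x0.
  by apply/eqP; lia.
rewrite /slinq (big_setD1 ord0) ?setU11//= sign_first// scale1r.
rewrite setU1K// -addrA -big_split/= big1 ?addr0// => x xJ.
have x0 : ord0 != x by apply: contraNneq zJ => ->.
have x_gt0 : (0 < x)%N.
  by rewrite lt0n; apply: contraNneq x0 => e; apply/eqP/ord_inj.
have -> : [set y in ord0 |: J | (y < x)%N] = ord0 |: [set y in J | (y < x)%N].
  apply/setP => y; rewrite !inE; have [->|//] := eqVneq y ord0.
  by rewrite /= x_gt0.
have -> : (ord0 |: J) :\ x = ord0 |: (J :\ x).
  apply/setP => y; rewrite !inE; have [->|//] := eqVneq y ord0.
  by rewrite x0.
by rewrite cardsU1 !inE (negPf zJ) add1n exprS mulN1r scaleNr addNr.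
Qed.
End Homotopy.

Section Acyclic.
Variable D : differential L.
Hypothesis D_linear : forall J, J != set0 ->
  D (sdeg J) (sgen (sdeg J) J) - slin J \in fil 2.

Lemma differential_sgen p J : sdeg J = p -> D p (sgen p J) - slinq (p - 1) J \in fil 2.
Proof.
move=> <-; have [->|J0] := eqVneq J set0; last first.
  by rewrite (slin_slinq (erefl (sdeg J - 1))) castL_id D_linear.
by rewrite sgen0 linear0 /slinq big_set0 subr0 rpred0.
Qed.

(** Generators are sums of eigenvectors: a_0 has eigenvalue 0, whereas a_J in
    positive dimension and a_i - a_0 have eigenvalue 1.  The decomposition
    a_J = (a_J - a_0) + a_0 covers all the cases, with a_0 read in the degree of
    J. *)
Lemma simplex_acyclic k p (z : L (p - 1)) : (0 < k)%N -> p - 1 <> - k%:Z ->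
  z \in fil k -> D _ z \in fil k.+1 ->
  exists2 y : L p, y \in fil k & z - D p y \in fil k.+1.
Proof.
have [h [h_sgen h_br]] := cone_exists; apply: (graded_acyclic h_br) => K.
set J := val K; have J0 : J != set0 := valP K.
have lap I q : sdeg I = q -> I != set0 ->
    laplacian D h (sgen q I) - (sgen q I - sgen q pt) \in fil 2.
  move=> Iq I0; rewrite -(cone_homotopy h_sgen Iq I0) /laplacian.
  rewrite opprD addrACA; apply: rpredD; last first.
    by rewrite -castLB -linearB castL_fil (homotopy_fil h_br)// differential_sgen.
  have q1 : sdeg pt != q + 1.
    by rewrite -Iq /sdeg cards1; move: I0; rewrite -card_gt0 => I0; apply/eqP; lia.
  rewrite h_sgen// (sgen_eq0 q1) subr0; case: ifPn => [zI|zI].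
    rewrite (setUidPr _) ?sub1set// sgen_eq0 ?linear0; last by apply/eqP; lia.
    by rewrite addr0 castL_fil rpred0.
  rewrite -(castL_slinq (degDh q)) -castLB castL_fil differential_sgen//.
  by rewrite /sdeg cardsU1 zI -Iq /sdeg; lia.
have [ptJ|ptJ] := eqVneq (sdeg pt) (sdeg J); last first.
  exists 1%N; rewrite -[gen _ _ _]addr0.
  apply: (EigenCons (m := 1)); last exact/EigenNil/rpred0.
  split=> //; first exact: fil1.
  by have := lap J _ erefl J0; rewrite (sgen_eq0 ptJ) subr0 scale1r sgen_val.
exists 2; rewrite -[gen _ _ _](subrK (sgen (sdeg J) pt)) -[X in _ + X]addr0.
have lapJ := lap J _ erefl J0.
have pt0 : pt != set0 by apply/set0Pn; exists ord0; rewrite inE.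
have := lap pt _ ptJ pt0; rewrite subrr subr0 => lapp.
apply: (EigenCons (m := 1)).
  split=> //; first exact: fil1.
  rewrite scale1r (laplacianB D h) -sgen_val addrAC; exact: rpredB.
apply: (EigenCons (m := 0)); last exact/EigenNil/rpred0.
split=> [||_]; first exact: fil1.
  by rewrite scale0r subr0.
by rewrite -[simplex_deg K]/(sdeg J) -ptJ /sdeg cards1.
Qed.
End Acyclic.
End SimplexContraction.

(** * Automorphisms built from top cells *)

Lemma fil_lpart1 (X : finType) (deg : X -> int) p (x : freeLie deg p) :
  x - lpart 1 x \in fil 2.
Proof.
apply/filP; exists (repr x - HSeries (cut_homog 1 (repr x))).
  by rewrite clsD clsN cls_repr.
move=> t t2; have t1 : tlen t = 1%N by have := tlen_gt0 t; lia.
have -> : hval (repr x - HSeries (cut_homog 1 (repr x))) t =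
  hval (repr x) t - cut 1 (hval (repr x)) t by [].
by rewrite /cut t1 eqxx subrr.
Qed.

Lemma enum_imset_incr n m (f : 'I_n -> 'I_m) (J : {set 'I_n}) :
  {homo f : x y / (x < y)%N} -> enum (f @: J) = map f (enum J).
Proof.
move=> f_incr; pose lt k := [rel x y : 'I_k | (x < y)%N].
have sorted_enum k (A : {set 'I_k}) : sorted (lt k) (enum A).
  rewrite /enum_mem; apply: sorted_filter; first by move=> ? ? ?; apply: ltn_trans.
  by have := iota_ltn_sorted 0 k; rewrite -val_enum_ord sorted_map enumT.
apply: (@irr_sorted_eq _ (lt m)).
- by move=> ? ? ?; apply: ltn_trans.
- by move=> ?; apply: ltnn.
- exact: sorted_enum.
- by apply: (homo_sorted f_incr); apply: sorted_enum.
- move=> y; rewrite mem_enum; apply/imsetP/mapP => -[x xJ ->].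
    by exists x; rewrite ?mem_enum.
  by exists x => //; rewrite mem_enum in xJ.
Qed.

Section TopCells.
Implicit Types (n m c : nat) (p : int).

Lemma sdegT n : sdeg [set: 'I_n.+1] = n%:Z - 1.
Proof. by rewrite /sdeg cardsT card_ord; lia. Qed.

(** Candidates for the images of the top cells of all simplices.  Each entry is a
    family over all degrees, of which only the degree of the cell matters. *)
Record tops := Tops {
  topcell :> forall n p, simplexLie n p;
  topcellP : forall n p, sdeg [set: 'I_n.+1] = p ->
    topcell n p - sgen p setT \in fil 2
}.
Implicit Types w : tops.

(** The image of the chosen top cell of the c-simplex under the map of vertices
    F; F is defined on all natural numbers so that c can be rewritten. *)
Definition place w n c (F : nat -> 'I_n.+1) p : simplexLie n p :=
  vertexMap (fun k : 'I_c.+1 => F k) p (w c p).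

Lemma eq_place w n c c' (F F' : nat -> 'I_n.+1) p :
  c = c' -> (forall k, (k <= c)%N -> F k = F' k) -> place w c F p = place w c' F' p.
Proof. by move=> <- FF'; apply: eq_vertexMap => k; apply: FF'; rewrite -ltnS. Qed.

(** On a_J: place the chosen top cell on the face J, along the increasing
    enumeration of J.  In this way compatibility with the cofaces is automatic
    ([cellMap_coface]). *)
Definition cellMap w n : lieHom (simplexLie n) (simplexLie n) :=
  sval (freeLie_lift (fun K : simplex n =>
    place w #|val K|.-1 (nth ord0 (enum (val K))) (simplex_deg K)
    : freeLie (@simplex_deg n) _)).

Lemma cellMap_sgen w n p (J : {set 'I_n.+1}) : sdeg J = p -> J != set0 ->
  cellMap w n p (sgen p J) = place w #|J|.-1 (nth ord0 (enum J)) p.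
Proof.
move=> <- J0.
have := svalP (freeLie_lift (fun K : simplex n =>
    place w #|val K|.-1 (nth ord0 (enum (val K))) (simplex_deg K)
    : freeLie (@simplex_deg n) _)) (Sub J J0).
by rewrite -sgen_val SubK.
Qed.

Lemma cellMap_top w n p : sdeg [set: 'I_n.+1] = p -> cellMap w n p (sgen p setT) = w n p.
Proof.
move=> Tp; rewrite cellMap_sgen//; last by apply/set0Pn; exists ord0.
rewrite (eq_place (c' := n) (F' := inord) w p).
- by apply: vertexMap_id => k; apply: inord_val.
- by rewrite cardsT card_ord.
move=> k; rewrite cardsT card_ord => kn; apply: ord_inj; rewrite inordK//.
have -> : enum [set: 'I_n.+1] = enum 'I_n.+1 by apply: eq_enum => x; rewrite inE.
by rewrite nth_enum_ord.
Qed.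

Lemma cellMap_coface w n (i : 'I_n.+2) p x :
  cellMap w n.+1 p (coface i p x) = coface i p (cellMap w n p x).
Proof.
apply: (simplexLie_ext (f := lieComp (cellMap w n.+1) (coface i))
  (g := lieComp (coface i) (cellMap w n))) => J /=.
have [->|J0] := eqVneq J set0; first by rewrite sgen0 !linear0.
have cJ : #|lift i @: J| = #|J| by rewrite card_imset//; apply: lift_inj.
rewrite coface_sgen !cellMap_sgen ?imset_eq0//; last by rewrite /sdeg cJ.
rewrite coface_vertexMap /place cJ vertexMap_comp enum_imset_incr; last first.
  by move=> a b; rewrite /= /bump; case: leqP; case: leqP; lia.
apply: eq_vertexMap => k; rewrite /= (nth_map ord0)// -cardE.
by rewrite (leq_trans (ltn_ord k))// prednK// card_gt0.
Qed.

Lemma cellMap_unipotent w n : unipotent (cellMap w n).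
Proof.
move=> K; set J := val K; have J0 : J != set0 := valP K.
rewrite -[simplex_deg K]/(sdeg J) -sgen_val cellMap_sgen//.
have Jgt0 : (0 < #|J|)%N by rewrite card_gt0.
have Jc : #|J|.-1.+1 = #|J| by rewrite prednK.
have Tdeg : sdeg [set: 'I_(#|J|.-1).+1] = sdeg J.
  by rewrite sdegT /sdeg; lia.
pose F (k : 'I_(#|J|.-1).+1) : 'I_n.+1 := nth ord0 (enum J) k.
have FT : F @: setT = J.
  apply/setP => y; apply/imsetP/idP => [[k _ ->]|yJ].
    by rewrite -mem_enum mem_nth// -cardE -[X in (_ < X)%N]Jc.
  have lt : (index y (enum J) < (#|J|.-1).+1)%N by rewrite Jc cardE index_mem mem_enum.
  by exists (Ordinal lt) => //; rewrite /F nth_index// mem_enum.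
have -> : sgen (sdeg J) (val K) = vertexMap F _ (sgen (sdeg J) setT).
  by rewrite vertexMap_sgen// FT.
rewrite -linearB; apply/lieHom_fil/topcellP; exact: Tdeg.
Qed.

Lemma cellMap_local w w' n p (J : {set 'I_n.+1}) :
  (forall m p, (m < n)%N -> w m p = w' m p) -> sdeg J = p -> J != setT ->
  cellMap w n p (sgen p J) = cellMap w' n p (sgen p J).
Proof.
move=> ww' Jp JT; have [->|J0] := eqVneq J set0; first by rewrite sgen0 !linear0.
rewrite !cellMap_sgen// /place ww'//.
have : (#|J| < #|[set: 'I_n.+1]|)%N by apply: proper_card; rewrite properEneq JT subsetT.
by rewrite cardsT card_ord; move: J0; rewrite -card_gt0; lia.
Qed.

Lemma eq_cellMap w w' n p x : (forall m p, (m <= n)%N -> w m p = w' m p) ->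
  cellMap w n p x = cellMap w' n p x.
Proof.
move=> ww'; apply: simplexLie_ext => J; have [->|JT] := eqVneq J setT.
  by rewrite !cellMap_top// ww'.
by apply: cellMap_local => // m q mn; apply/ww'/ltnW.
Qed.

Definition cellMapV w n : lieHom (simplexLie n) (simplexLie n) :=
  sval (unipotent_inverse (@cellMap_unipotent w n)).

Lemma cellMapVK w n p x : cellMap w n p (cellMapV w n p x) = x.
Proof. exact: (proj2 (svalP (unipotent_inverse (@cellMap_unipotent w n)))). Qed.

Lemma cellMapK w n p x : cellMapV w n p (cellMap w n p x) = x.
Proof. exact: (proj1 (svalP (unipotent_inverse (@cellMap_unipotent w n)))). Qed.

Lemma cellMapV_coface w n (i : 'I_n.+2) p x :
  cellMapV w n.+1 p (coface i p x) = coface i p (cellMapV w n p x).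
Proof. by rewrite -{1}(cellMapVK w x) -cellMap_coface cellMapK. Qed.
End TopCells.

(** * Straightening the differentials *)

Section Straighten.
Variable D : forall n, differential (simplexLie n).
Hypothesis hD : compatible_models D.
Implicit Types (n m k : nat) (p : int) (w : tops).

Definition conjD w n : differential (simplexLie n) :=
  conj_differential (D n) (cellMapK w (n := n)) (cellMapVK w (n := n)).

Lemma cellMap_conjD w n p x : cellMap w n _ (conjD w n p x) = D n p (cellMap w n p x).
Proof. exact: cellMapVK. Qed.

(** Cofaces commute both with D and with the automorphisms. *)
Lemma conjD_coface w n (i : 'I_n.+2) p x :
  conjD w n.+1 p (coface i p x) = coface i _ (conjD w n p x).
Proof.
by rewrite !conj_differentialE cellMap_coface -(models_coface hD i) cellMapV_coface.
Qed.

Lemma conjD_linear w n (J : {set 'I_n.+1}) : J != set0 ->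
  conjD w n (sdeg J) (sgen (sdeg J) J) - slin J \in fil 2.
Proof.
move=> J0; apply: (unipotent_reflect (@cellMap_unipotent w n)).
rewrite linearB /= cellMap_conjD.
set a : simplexLie n (sdeg J) := sgen (sdeg J) J.
have -> : D n _ (cellMap w n _ a) - cellMap w n _ (slin J)
    = D n _ (cellMap w n _ a - a) + (D n _ a - slin J) - (cellMap w n _ (slin J) - slin J).
  by rewrite linearB [D n _ _ - _ + _]addrA subrK opprB addrA subrK.
apply: rpredB; last exact: unipotent_fil (@cellMap_unipotent w n) _ _ _ (fil1 _).
apply: rpredD; last by rewrite -(models_linear hD J0); apply: fil_lpart1.
apply: differential_fil.
exact: unipotent_fil (@cellMap_unipotent w n) _ _ _ (fil1 _).
Qed.

Lemma eq_conjD w w' n p x : (forall m p, (m <= n)%N -> w m p = w' m p) ->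
  conjD w n p x = conjD w' n p x.
Proof.
move=> ww'; rewrite -[LHS](cellMapK w') -(eq_cellMap _ ww') cellMap_conjD (eq_cellMap _ ww').
by rewrite -cellMap_conjD cellMapK.
Qed.

(** Straight at n: the conjugate differentials of levels n + 1 and n commute with
    the standard codegeneracies between these levels. *)
Definition straight w n := forall (i : 'I_n.+1) p x,
  vertexMap (codegen i) _ (conjD w n.+1 p x) = conjD w n p (vertexMap (codegen i) p x).

(** A generator of the boundary is in the image of a coface j.  The composite of
    the codegeneracy with the coface j is either the identity or a codegeneracy
    followed by a coface, and the levels below n are straight. *)
Lemma straight_proper w n (i : 'I_n.+1) p (J : {set 'I_n.+2}) :
  (forall m, (m < n)%N -> straight w m) -> J != setT ->
  vertexMap (codegen i) _ (conjD w n.+1 p (sgen p J))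
    = conjD w n p (vertexMap (codegen i) p (sgen p J)).
Proof.
move=> straight_lt JT.
have [j jJ] : exists j, j \notin J.
  by move: JT; rewrite -subTset => /subsetPn[j _ jJ]; exists j.
have -> : sgen p J = coface j p (sgen p (lift j @^-1: J)).
  rewrite coface_sgen; congr (sgen p _); apply/setP => x.
  apply/idP/imsetP => [xJ|[y]]; last by rewrite inE => yJ ->.
  have [y xE|xj] := unliftP j x; first by exists y; rewrite ?inE -?xE.
  by rewrite -xj xJ in jJ.
move: (sgen p _) => x; have C := vertexMap_cosimplicial.
rewrite conjD_coface.
have [ij|ij] := boolP ((j == i :> nat) || (j == i.+1 :> nat)).
  have ij' : j = i :> nat \/ j = i.+1 :> nat by case/orP: ij => /eqP; [left|right].
  by rewrite !(cosimplicial_sd_id C ij').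
case: n i j J x straight_lt ij JT jJ => [|n] i j J x straight_lt ij JT jJ.
  by move: ij (ltn_ord i) (ltn_ord j); lia.
have straight_n := straight_lt n (ltnSn n).
have [ji|ij'] := ltnP j i.
  have jlt : (j < n.+2)%N by have := ltn_ord i; lia.
  have ilt : (i.-1 < n.+1)%N by have := ltn_ord i; lia.
  have ei : i = (Ordinal ilt).+1 :> nat by rewrite /=; lia.
  rewrite !(cosimplicial_sd_lt C (i' := Ordinal jlt) (erefl : Ordinal jlt = j :> nat) ei ji).
  by rewrite straight_n conjD_coface.
have jlt : (j.-1 < n.+2)%N by have := ltn_ord j; lia.
have ilt : (i < n.+1)%N by have := ltn_ord j; lia.
have ej : j = (Ordinal jlt).+1 :> nat by rewrite /=; lia.
have ij2 : (i.+1 < j)%N by lia.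
rewrite !(cosimplicial_sd_gt C (j' := Ordinal ilt) ej erefl ij2).
by rewrite straight_n conjD_coface.
Qed.
End Straighten.

(** Replaces the choice at a single level. *)
Lemma update_topcell (w : tops) n (v : simplexLie n (sdeg [set: 'I_n.+1])) :
  v - sgen _ setT \in fil 2 ->
  exists w' : tops, (forall m p, m <> n -> w' m p = w m p) /\ w' n _ = v.
Proof.
move=> vP; pose c m p : simplexLie m p :=
  if n =P m is ReflectT e then
    ecast i (simplexLie i p) e
      (if sdeg [set: 'I_n.+1] =P p is ReflectT e' then castL e' v else 0)
  else w m p.
have cn : c n _ = v.
  by rewrite /c; case: eqP => // e; case: eqP => // e'; rewrite (eq_axiomK e) castL_id.
have cm m p : m <> n -> c m p = w m p by rewrite /c; case: eqP => // e; case; rewrite e.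
have cP m p : sdeg [set: 'I_m.+1] = p -> c m p - sgen p setT \in fil 2.
  move=> <-; have [->|/eqP mn] := eqVneq m n; first by rewrite cn.
  by rewrite cm//; apply: topcellP.
by exists (Tops cP).
Qed.

Section Level.
Variable D : forall n, differential (simplexLie n).
Hypothesis hD : compatible_models D.
Variable n : nat.
Implicit Types (m k : nat) (p : int) (w : tops).
Local Notation T := [set: 'I_n.+2].
Local Notation a := (sgen (sdeg T) T : simplexLie n.+1 (sdeg T)).
Local Notation top w := (topcell w n.+1 (sdeg T)).
Local Notation agree w w' := (forall m p, (m < n.+1)%N -> topcell w m p = topcell w' m p).
Local Notation omega w := (conjD D w n.+1 (sdeg T) a).

Lemma setD1_neqT (x : 'I_n.+2) : T :\ x != T.
Proof. by apply/negP => /eqP/setP/(_ x); rewrite !inE eqxx. Qed.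

Lemma cellMap_close w w' k l p (x : simplexLie n.+1 p) :
  agree w w' -> top w - top w' \in fil k.+1 -> x \in fil l.+1 ->
  cellMap w n.+1 p x - cellMap w' n.+1 p x \in fil (k + l.+1).
Proof.
move=> ww' tt'; apply: lieHom_close => K; rewrite -sgen_val.
rewrite -[simplex_deg K]/(sdeg (val K)).
have [->|KT] := eqVneq (val K) T; first by rewrite !cellMap_top.
by rewrite (cellMap_local (w' := w'))// subrr rpred0.
Qed.

Lemma cellMap_slin w w' : agree w w' ->
  cellMap w n.+1 _ (slin T) = cellMap w' n.+1 _ (slin T).
Proof.
move=> ww'; rewrite /slin !lhom_sum; apply: eq_bigr => x _; rewrite !lhomZ.
by rewrite (cellMap_local (w' := w'))// ?sdegD1 ?inE// setD1_neqT.
Qed.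

Lemma cellMap_omega w : cellMap w n.+1 _ (omega w) = D n.+1 _ (top w).
Proof. by rewrite cellMap_conjD cellMap_top. Qed.

Lemma omega_linear w : omega w - slin T \in fil 2.
Proof. by apply: conjD_linear => //; apply/set0Pn; exists ord0; rewrite inE. Qed.

(** omega depends continuously on the choice at level n + 1. *)
Lemma omega_close w w' k : agree w w' -> top w - top w' \in fil k.+1 ->
  omega w - omega w' \in fil k.+1.
Proof.
move=> ww' tt'; apply: (unipotent_reflect (@cellMap_unipotent w n.+1)).
have -> : cellMap w n.+1 _ (omega w - omega w') =
    D n.+1 _ (top w - top w') - (cellMap w n.+1 _ (omega w') - cellMap w' n.+1 _ (omega w')).
  by rewrite lhomB dfunB !cellMap_omega opprB addrA subrK.
apply: rpredB; first exact: differential_fil.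
by apply: filW (cellMap_close ww' tt' (fil1 _)); rewrite addn1.
Qed.

(** To first order, moving the top cell by psi y moves omega by D' y.  The new
    automorphism differs from the old one only in brackets that contain the top
    cell, and these have length at least 2 in omega because its linear part
    lies in the boundary; so the change of automorphism is of higher order. *)
Lemma omega_perturb w w' k (y : simplexLie n.+1 (sdeg T)) :
  agree w w' -> y \in fil k.+2 -> top w' = top w + cellMap w n.+1 _ y ->
  omega w' - (omega w + conjD D w n.+1 _ y) \in fil k.+3.
Proof.
move=> ww' yk w'E; apply: (unipotent_reflect (@cellMap_unipotent w' n.+1)).
set u := omega w + _.
have -> : cellMap w' n.+1 _ (omega w' - u) = cellMap w n.+1 _ u - cellMap w' n.+1 _ u.
  by rewrite lhomB cellMap_omega w'E dfunD -cellMap_omega -cellMap_conjD -lhomD.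
have u2 : u - slin T \in fil 2.
  rewrite /u (addrAC (omega w)); apply: rpredD; first exact: omega_linear.
  by apply/differential_fil/(filW _ yk).
have -> : cellMap w n.+1 _ u - cellMap w' n.+1 _ u
    = cellMap w n.+1 _ (u - slin T) - cellMap w' n.+1 _ (u - slin T).
  by rewrite !lhomB (cellMap_slin ww') opprB addrA subrK.
have tt' : top w - top w' \in fil k.+2.
  rewrite w'E opprD addrA subrr add0r rpredN; exact: lieHom_fil.
by apply: filW (cellMap_close ww' tt' u2); lia.
Qed.

(** The composite of the degeneracy i, the face i + 1 and the degeneracy j < i
    factors through the degeneracy j, followed by moving i to i - 1. *)
Lemma bump_unbump (i j b : nat) : (j < i)%N ->
  unbump j (bump (bump 0 i) (unbump i b))
    = if unbump j b == i then i.-1 else unbump j b.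
Proof.
rewrite /unbump /bump /= => ji.
by case: (ltnP i b) => ib; case: (ltnP j b) => jb; case: eqP; lia.
Qed.

Section Normalize.
Variables (w : tops) (k : nat).
Hypothesis straight_lt : forall m, (m < n)%N -> straight D w m.
Local Notation s i := (vertexMap (@codegen n i)).
Local Notation E := (conjD D w n.+1).
Local Notation E' := (conjD D w n).
Hypothesis omega_fil : forall i, s i _ (omega w) \in fil k.+2.

Lemma codegen_top i : s i _ a = 0.
Proof.
rewrite vertexMap_sgen// sgen_eq0//.
have : (#|codegen i @: T| <= #|[set: 'I_n.+1]|)%N by apply/subset_leq_card/subsetT.
rewrite cardsT card_ord => le; apply/eqP; rewrite /sdeg => /addIr[e].
by rewrite e cardsT card_ord ltnn in le.
Qed.

Lemma codegen_commutator i l p (x : simplexLie n.+1 p) : x \in fil l.+1 ->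
  s i _ (E p x) - E' p (s i p x) \in fil (k.+1 + l.+1).
Proof.
apply: commutator_fil => K; rewrite -sgen_val -[simplex_deg K]/(sdeg (val K)).
have [->|KT] := eqVneq (val K) T.
  by rewrite codegen_top dfun0 subr0; apply: omega_fil.
by rewrite straight_proper// subrr rpred0.
Qed.

(** Since D' omega = 0, this is minus the commutator of the codegeneracy with D'
    at omega; it vanishes on the linear part of omega, which lies in the
    boundary. *)
Lemma codegen_omega_cycle i : E' _ (s i _ (omega w)) \in fil k.+3.
Proof.
have EE : s i _ (E _ (omega w)) = 0 by rewrite dfun_sq lhom0.
have slinE : s i _ (E _ (slin T)) = E' _ (s i _ (slin T)).
  rewrite /slin dfun_sum !lhom_sum dfun_sum; apply: eq_bigr => x _.
  rewrite dfunZ !lhomZ dfunZ.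
  by rewrite straight_proper// setD1_neqT.
rewrite -rpredN.
have -> : - E' _ (s i _ (omega w))
  = s i _ (E _ (omega w - slin T)) - E' _ (s i _ (omega w - slin T)).
  by rewrite dfunB !lhomB dfunB slinE EE opprB addrA subrK sub0r.
by apply: filW (codegen_commutator i (omega_linear w)); lia.
Qed.

(** Eliminates the codegeneracy i without spoiling those before it: the face i + 1
    is a section of the degeneracy i, and by [bump_unbump] the correction stays
    in the kernel of every earlier codegeneracy. *)
Lemma normalize_step (i : 'I_n.+1) (z : simplexLie n.+1 (sdeg T - 1)) :
  (forall j : 'I_n.+1, (j < i)%N -> s j _ (omega w - z) = 0) ->
  let z' := z + coface (lift ord0 i) _ (s i _ (omega w - z)) in
  forall j : 'I_n.+1, (j < i.+1)%N -> s j _ (omega w - z') = 0.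
Proof.
set u := omega w - z => uj z' j; rewrite ltnS leq_eqVlt.
have -> : omega w - z' = u - coface (lift ord0 i) _ (s i _ u).
  by rewrite /z' opprD addrA.
rewrite lhomB; case: (ltngtP j i) => [ji _|//|/ord_inj ji _].
  rewrite coface_vertexMap !vertexMap_comp (uj j ji) sub0r.
  pose g (b : 'I_n.+1) : 'I_n.+1 := if b == i then inord i.-1 else b.
  have -> : vertexMap (codegen j \o (lift (lift ord0 i) \o codegen i)) _ u = vertexMap (g \o codegen j) _ u.
    apply: eq_vertexMap => b; apply: ord_inj; rewrite /= /g -val_eqE (fun_if val) /=.
    rewrite !val_codegen /= inordK; last by have := ltn_ord i; lia.
    by rewrite !val_codegen bump_unbump.
  by rewrite -vertexMap_comp uj// lhom0 oppr0.
rewrite (cosimplicial_sd_id vertexMap_cosimplicial (i := lift ord0 i) (j := j)) ?ji ?subrr//.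
by right; rewrite /= /bump.
Qed.

(** The part of omega seen by the codegeneracies can be represented in [fil k] by a
    cycle modulo longer brackets. *)
Lemma normalize : exists z : simplexLie n.+1 (sdeg T - 1),
  [/\ z \in fil k.+2, E _ z \in fil k.+3 & forall i, s i _ z = s i _ (omega w)].
Proof.
have main t : (t <= n.+1)%N -> exists z : simplexLie n.+1 (sdeg T - 1),
    [/\ z \in fil k.+2, E _ z \in fil k.+3
      & forall j : 'I_n.+1, (j < t)%N -> s j _ (omega w - z) = 0].
  elim: t => [_|t IHt tn]; first by exists 0; split; rewrite ?dfun0 ?rpred0.
  have [z [zk Ez sz]] := IHt (ltnW tn); pose i := Ordinal tn.
  exists (z + coface (lift ord0 i) _ (s i _ (omega w - z))); split.
  - apply: rpredD => //; apply: lieHom_fil; rewrite lhomB.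
    by apply: rpredB; [apply: omega_fil|apply: lieHom_fil].
  - rewrite dfunD conjD_coface//; apply: rpredD => //; apply: lieHom_fil.
    rewrite lhomB dfunB; apply: rpredB; first exact: codegen_omega_cycle.
    rewrite -(subKr (s i _ (E _ z)) (E' _ _)); apply: rpredB.
      exact: lieHom_fil.
    by apply: filW (codegen_commutator i zk); lia.
  - exact: (@normalize_step i z sz).
have [z [zk Ez sz]] := main n.+1 (leqnn _); exists z; split=> // i.
by apply/esym/eqP; rewrite -subr_eq0 -lhomB sz.
Qed.

Lemma straighten_step : exists w', [/\ agree w w',
  top w' - top w \in fil k.+2 & forall i, s i _ (omega w') \in fil k.+3].
Proof.
have [z [zk Ez sz]] := normalize.
have degN : sdeg T - 1 <> - (k.+2)%:Z by rewrite sdegT; lia.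
have [y yk zy] := simplex_acyclic (@conjD_linear _ hD w n.+1) (ltn0Sn _) degN zk Ez.
have yk' : - y \in fil k.+2 by rewrite rpredN.
have py : cellMap w n.+1 _ (- y) \in fil k.+2 by apply: lieHom_fil.
have [|w' [ww' w'E]] := @update_topcell w n.+1 (top w + cellMap w n.+1 _ (- y)).
  rewrite (addrAC (top w)); apply: rpredD; first exact: topcellP.
  by apply: filW py.
have aw : agree w w' by move=> m p mn; rewrite ww'//; lia.
exists w'; split=> // [|i]; first by rewrite w'E addrAC subrr add0r.
have := omega_perturb aw yk' w'E; set u := omega w + _ => wu.
rewrite -(subrK u (omega w')) lhomD; apply: rpredD; first exact: lieHom_fil.
by rewrite /u lhomD dfunN lhomN -sz -lhomB; apply: lieHom_fil.
Qed.
End Normalize.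

(** Iterates [straighten_step] and passes to the limit of the top cells; by
    [omega_close] and continuity all the codegeneracies kill the limit omega. *)
Lemma straighten_level w : (forall m, (m < n)%N -> straight D w m) ->
  exists w', agree w w' /\ straight D w' n.
Proof.
move=> straight_lt.
have straight_agree w' : agree w w' -> forall m, (m < n)%N -> straight D w' m.
  move=> ww' m mn i p x.
  rewrite -!(@eq_conjD D w w'); first exact: straight_lt.
    by move=> l q lm; apply: ww'; lia.
  by move=> l q lm; apply: ww'; lia.
pose inv k w' := agree w w' /\ forall i, vertexMap (@codegen n i) _ (omega w') \in fil k.+2.
have step k (w1 : tops) :
    {w2 | inv k w1 -> inv k.+1 w2 /\ top w2 - top w1 \in fil k.+2}.
  apply: cid; have [[ww1 sk]|no] := pselect (inv k w1); last by exists w1.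
  have [w2 [w12 t12 s2]] := straighten_step (straight_agree _ ww1) sk.
  by exists w2 => _; split=> //; split=> // m p mn; rewrite ww1// w12.
pose u := fix u k := if k is k'.+1 then sval (step k' (u k')) else w.
have uP k : inv k (u k).
  elim: k => [|k IHk]; last exact: (proj1 (svalP (step k (u k)) IHk)).
  (* At the start s_i omega is in fil 2, as its linear part is killed. *)
  split=> // i; rewrite -(subrK (slin T) (omega w)) lhomD vertexMap_codegen_slin addr0.
  exact/lieHom_fil/omega_linear.
have uS k : top (u k.+1) - top (u k) \in fil k.+2.
  exact: (proj2 (svalP (step k (u k)) (uP k))).
have [v vu] : exists v, forall k, v - top (u k) \in fil k.
  by apply: fil_complete => k; apply: filW (uS k); lia.
have [|w' [ww' w'E]] := @update_topcell w n.+1 v.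
  rewrite -(subrK (top (u 2)) v) -addrA; apply: rpredD; first exact: vu.
  exact: topcellP.
have aw : agree w w' by move=> m p mn; rewrite ww'//; lia.
exists w'; split=> // i; apply: dgl_hom_gen => K; rewrite -sgen_val.
rewrite -[simplex_deg K]/(sdeg (val K)).
have [->|KT] := eqVneq (val K) T; last exact/straight_proper/KT/straight_agree.
rewrite codegen_top dfun0; apply: fil_separated => k; apply: (filW (leqnSn k)).
have [au su] := uP k.+1.
rewrite -(subrK (omega (u k.+1)) (omega w')) lhomD; apply: rpredD.
  apply/lieHom_fil/omega_close; last by rewrite w'E; apply: vu.
  by move=> m p mn; rewrite -aw// au.
by apply: filW (su i); lia.
Qed.
End Level.

Fact standard_topcellP n p : sdeg [set: 'I_n.+1] = p ->
  sgen p setT - sgen p setT \in (fil 2 : {pred simplexLie n p}).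
Proof. by rewrite subrr rpred0. Qed.

(** Level n + 1 is chosen at step n and never changed later; straightness at n
    only depends on the choices up to level n + 1. *)
Lemma straighten (D : forall n, differential (simplexLie n)) :
  compatible_models D -> exists w, forall n, straight D w n.
Proof.
move=> hD.
have step n (w : tops) : {w' : tops | (forall m, (m < n)%N -> straight D w m) ->
    (forall m p, (m < n.+1)%N -> w m p = w' m p) /\ straight D w' n}.
  apply: cid; have [S|no] := pselect (forall m, (m < n)%N -> straight D w m).
    by have [w' [? ?]] := straighten_level hD S; exists w'.
  by exists w.
pose W := fix W n := if n is n'.+1 then sval (step n' (W n')) else Tops standard_topcellP.
have eq_straight (w w' : tops) n : (forall m p, (m <= n.+1)%N -> w m p = w' m p) ->
    straight D w n -> straight D w' n.
  move=> ww' S i p x; rewrite -!(@eq_conjD D w w'); first exact: S.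
    by move=> m q mn; apply: ww'; lia.
  by move=> m q mn; apply: ww'; lia.
have WP n : forall m, (m < n)%N -> straight D (W n) m.
  elim: n => [//|n IHn] m; have [WW S] := svalP (step n (W n)) IHn.
  rewrite ltnS leq_eqVlt => /predU1P[->//|mn].
  by apply: eq_straight (IHn m mn) => l p lm; apply: WW; lia.
have Wagree n m p : (m <= n)%N -> W m m p = W n m p.
  elim: n => [|n IHn]; first by rewrite leqn0 => /eqP->.
  rewrite leq_eqVlt => /predU1P[->//|mn]; rewrite IHn//.
  by have [WW _] := svalP (step n (W n)) (WP n); apply: WW.
exists (@Tops (fun n p => W n n p) (fun n p => topcellP (W n) (p := p))) => n.
apply: (eq_straight (W n.+1)) => [m p mn|]; last exact: WP.
exact/esym/Wagree.
Qed.

Theorem theoremA (D : forall n : nat, differential (simplexLie n))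
    (hD : compatible_models D) :
  exists sigma : forall n : nat,
      'I_n.+1 -> lieHom (simplexLie n.+1) (simplexLie n),
    cosimplicial_dgl D coface sigma.
Proof.
have [w S] := straighten hD; have C := vertexMap_cosimplicial.
exists (fun n i => lieComp (cellMap w n) (lieComp (vertexMap (@codegen n i)) (cellMapV w n.+1))).
split=> [|n i p x|].
- exact: models_coface.
- have DpsiV q (y : simplexLie n.+1 q) : cellMapV w n.+1 _ (D n.+1 q y) =
      conjD D w n.+1 q (cellMapV w n.+1 q y) by rewrite conj_differentialE cellMapVK.
  by rewrite /= DpsiV S cellMap_conjD.
split=> n.
- exact: (cosimplicial_dd C).
- move=> i j1 i' j ei ej ij p x /=; rewrite !cellMapK.
  by rewrite (cosimplicial_ss C ei ej ij).
- move=> i j i' j1 ei ej ij p x /=; rewrite cellMapV_coface.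
  by rewrite (cosimplicial_sd_lt C ei ej ij) cellMap_coface.
- move=> i j ij p x /=; rewrite cellMapV_coface (cosimplicial_sd_id C ij); exact: cellMapVK.
- move=> i j i1 j' ei ej ij p x /=; rewrite cellMapV_coface.
  by rewrite (cosimplicial_sd_gt C ei ej ij) cellMap_coface.
Qed.
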